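(* Let $\kappa$ be a regular uncountable cardinal, let $U\subseteq{}^{<\kappa}\kappa$ be a slim downward-closed $\kappa$-tree, and suppose $\mathrm{P}_{14}(\kappa,\sqsubseteq,1,\{\kappa\})$ holds. Then there exists a downward-closed $T\subseteq{}^{<\kappa}\kappa$ which is a prolific slim $\kappa$-Souslin tree admitting an injective $(\mathcal F^{\mathrm{fin}}_{\aleph_0},U)$-ascent path.
   Context: Downward-closed subsets of ${}^{<\kappa}\kappa$ are ordered by $\subsetneq$; height is $\mathrm{dom}$; $T_\alpha=T\cap{}^\alpha\kappa$. Prolific: $x^\frown\langle i\rangle\in T$ for all $x\in T_\alpha$, $\alpha<\kappa$, $i<\max\{\omega,\alpha\}$. Slim: $|T_\alpha|\le\max\{|\alpha|,\aleph_0\}$. $\kappa$-tree: height $\kappa$, levels of size $<\kappa$; $\kappa$-Souslin: $\kappa$-tree with no cofinal branch and no antichain of size $\kappa$. $\mathcal F^{\mathrm{fin}}_{\aleph_0}=\{Z\subseteq\omega\mid\omega\setminus Z$ finite$\}$. An $(\mathcal F,U)$-ascent path through $T$ is $\langle f_u\mid u\in U\rangle$ with $f_u:\bigcup\mathcal F\to T_{\mathrm{dom}(u)}$, $\{i\mid f_u(i)\subsetneq f_v(i)\}\in\mathcal F$ for $u\subsetneq v$ in $U$, and $\{i\mid f_u(i)\ne f_v(i)\}\in\mathcal F$ for distinct $u,v\in U$ of the same domain; it is injective if for every $b:\kappa\to\kappa$ with $\{b\restriction\alpha\mid\alpha<\kappa\}\subseteq U$ there are $\alpha<\kappa$ and $I\in\mathcal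 F$ with $f_{b\restriction\alpha}\restriction I$ injective. $\mathrm{P}_{14}(\kappa,\sqsubseteq,1,\{\kappa\})$: $\diamondsuit(\kappa)$ holds and there is $\langle C_\alpha\mid\alpha<\kappa\rangle$ with $C_\alpha$ club in $\alpha$ for limit $\alpha$, $C_{\bar\alpha}=C_\alpha\cap\bar\alpha$ whenever $\bar\alpha\in\mathrm{acc}(C_\alpha)=\{\gamma\in C_\alpha\mid\sup(C_\alpha\cap\gamma)=\gamma>0\}$, and for every cofinal $A\subseteq\kappa$ there are stationarily many $\alpha<\kappa$ with $\sup\{\beta\in C_\alpha\mid\mathrm{succ}_\omega(C_\alpha\setminus\beta)\subseteq A\}=\alpha$, where $\mathrm{succ}_\omega(D)=\{\delta\in D\mid0<\mathrm{otp}(D\cap\delta)<\omega\}$. *)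

(* Defs.v *)
(* The regular uncountable cardinal kappa is modelled as a type
   K carrying a strict well-order lt (so elements of K are the ordinals < kappa).
   Elements of ^{<kappa}kappa are modelled as partial functions K -> option K
   whose domain is an initial segment {g | lt g a} with a in K. *)
From Stdlib Require Import List Classical ClassicalEpsilon.
Set Implicit Arguments.

Section Defs.
Variables (K : Type) (lt : K -> K -> Prop).

Definition le (a b : K) : Prop := lt a b \/ a = b.

Definition strict_wellorder : Prop :=
  (forall a, ~ lt a a) /\
  (forall a b c, lt a b -> lt b c -> lt a c) /\
  (forall a b, lt a b \/ a = b \/ lt b a) /\
  well_founded lt.

Definition le_card {X Y : Type} (A : X -> Prop) (B : Y -> Prop) : Prop :=
  exists f : X -> Y, (forall x, A x -> B (f x)) /\
    (forall x y, A x -> A y -> f x = f y -> x = y).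
Definition lt_card {X Y : Type} (A : X -> Prop) (B : Y -> Prop) : Prop :=
  le_card A B /\ ~ le_card B A.

Definition finite_set {X : Type} (P : X -> Prop) : Prop :=
  exists s : list X, forall x, P x -> In x s.

Definition cofinal (A : K -> Prop) : Prop :=
  forall a, exists b, A b /\ le a b.

Definition regular : Prop :=
  forall A : K -> Prop, cofinal A -> ~ exists a, le_card A (fun b => lt b a).
Definition uncountable : Prop :=
  ~ le_card (fun _ : K => True) (fun _ : nat => True).

Definition is_sup (S : K -> Prop) (a : K) : Prop :=
  (forall b, S b -> le b a) /\ (forall g, lt g a -> exists b, S b /\ lt g b).

Definition is_limit (a : K) : Prop :=
  (exists b, lt b a) /\ (forall b, lt b a -> exists g, lt b g /\ lt g a).

Definition club (E : K -> Prop) : Prop :=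
  (forall a, exists b, E b /\ lt a b) /\
  (forall g, (exists d, lt d g) -> is_sup (fun b => E b /\ lt b g) g -> E g).
Definition stationary (S : K -> Prop) : Prop :=
  forall E, club E -> exists a, E a /\ S a.

Definition diamond : Prop :=
  exists A : K -> K -> Prop, (forall a b, A a b -> lt b a) /\
    forall X : K -> Prop, stationary (fun a => forall b, lt b a -> (X b <-> A a b)).

Definition club_in (a : K) (D : K -> Prop) : Prop :=
  (forall b, D b -> lt b a) /\
  (forall b, lt b a -> exists g, D g /\ lt b g) /\
  (forall g, lt g a -> (exists d, lt d g) -> is_sup (fun b => D b /\ lt b g) g -> D g).

Definition acc (D : K -> Prop) (g : K) : Prop :=
  D g /\ (exists d, lt d g) /\ is_sup (fun b => D b /\ lt b g) g.

(* succ_omega(D) = {d in D | 0 < otp(D cap d) < omega} *)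
Definition succ_omega (D : K -> Prop) (d : K) : Prop :=
  D d /\ (exists e, D e /\ lt e d) /\ finite_set (fun e => D e /\ lt e d).

Definition P14 : Prop :=
  diamond /\
  exists C : K -> K -> Prop,
    (forall a, is_limit a -> club_in a (C a)) /\
    (forall a g, acc (C a) g -> forall b, C g b <-> (C a b /\ lt b g)) /\
    (forall A : K -> Prop, cofinal A ->
       stationary (fun a =>
         is_sup (fun b => C a b /\
                   forall d, succ_omega (fun e => C a e /\ ~ lt e b) d -> A d) a)).

Definition node := K -> option K.
Definition hasdom (x : node) (a : K) : Prop := forall g, x g <> None <-> lt g a.
Definition is_node (x : node) : Prop := exists a, hasdom x a.

Definition sub (x y : node) : Prop :=
  exists a b, hasdom x a /\ hasdom y b /\ lt a b /\ forall g, lt g a -> x g = y g.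

Definition restr (x : node) (b : K) : node :=
  fun g => if excluded_middle_informative (lt g b) then x g else None.
Definition brestr (f : K -> K) (b : K) : node :=
  fun g => if excluded_middle_informative (lt g b) then Some (f g) else None.
(* x ^ <i>, where dom x = a *)
Definition ext (x : node) (a i : K) : node :=
  fun g => if excluded_middle_informative (g = a) then Some i else x g.

Definition level (T : node -> Prop) (a : K) : node -> Prop :=
  fun x => T x /\ hasdom x a.

Definition downward_closed (T : node -> Prop) : Prop :=
  (forall x, T x -> is_node x) /\
  (forall x a b, T x -> hasdom x a -> le b a -> T (restr x b)).

Definition prolific (T : node -> Prop) : Prop :=
  forall a x i, level T a x -> (lt i a \/ finite_set (fun g => lt g i)) ->
    T (ext x a i).

Definition slim (T : node -> Prop) : Prop :=
  forall a, le_card (level T a)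
    (fun s : K + nat => match s with inl b => lt b a | inr _ => True end).

Definition kappa_tree (T : node -> Prop) : Prop :=
  (forall a, exists x, level T a x) /\
  (forall a, lt_card (level T a) (fun _ : K => True)).

Definition antichain (T A : node -> Prop) : Prop :=
  (forall x, A x -> T x) /\
  (forall x y, A x -> A y -> x <> y -> ~ sub x y /\ ~ sub y x).

Definition kappa_souslin (T : node -> Prop) : Prop :=
  kappa_tree T /\
  (~ exists b : K -> K, forall a, T (brestr b a)) /\
  (~ exists A, antichain T A /\ le_card (fun _ : K => True) A).

Definition cofinite (Z : nat -> Prop) : Prop :=
  finite_set (fun i => ~ Z i).

Definition ascent_path (T U : node -> Prop) (f : node -> nat -> node) : Prop :=
  (forall u a, U u -> hasdom u a -> forall i, level T a (f u i)) /\
  (forall u v, U u -> U v -> sub u v -> cofinite (fun i => sub (f u i) (f v i))) /\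
  (forall u v a, U u -> U v -> hasdom u a -> hasdom v a -> u <> v ->
     cofinite (fun i => f u i <> f v i)).

Definition injective_ascent_path (T U : node -> Prop) (f : node -> nat -> node) : Prop :=
  ascent_path T U f /\
  forall b : K -> K, (forall a, U (brestr b a)) ->
    exists a (I : nat -> Prop), cofinite I /\
      forall i j, I i -> I j -> f (brestr b a) i = f (brestr b a) j -> i = j.

End Defs.

(* Main.v *)
From Stdlib Require Import List Arith Lia Classical ClassicalEpsilon.
From Stdlib Require Import FunctionalExtensionality PropExtensionality.
Require Import Defs.
Set Implicit Arguments.
Unset Strict Implicit.

(* The levels T_a and the values f_u (dom u = a) are built together by recursion on a.
   A successor level adds all the extensions that prolificness asks for, and f_u branches
   injectively in u and in the index.  At a limit a, every node x below a gets a branch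
   running along C_a: at each successor point b of C_a it moves to an extension in T_b
   that lies above an element of the set guessed by diamond at b, if there is one.  The
   node f_u(n) is the limit of a similar branch that starts at the root and, at the k-th
   point b of each omega-block of C_a, moves to f_(u|b)(n) if k < n and that is possible,
   and is otherwise sealed in the same way.  By coherence of the C-sequence these branches
   do not leave the tree at accumulation points of C_a, where f_(u|b)(n) is the very node
   reached by the n-th branch; hence the n-th branch agrees with f_(u|b)(n) for all but
   finitely many n at every b in C_a, which gives the ascent path.

   For an antichain A consider the dense set of nodes that extend an element of A or have
   no extension that does.  The set of b at which it is guessed correctly is cofinal, so P14
   gives an a such that cofinally in C_a there are omega consecutive points inside that
   set; every node of T_a is then sealed, so A lives below a and has size less than kappa. *)

(** * Well-founded recursion and comparison of cardinalities *)

Definition cut {X Y : Type} (R : X -> X -> Prop) (d : Y) (x : X) (f : X -> Y) : X -> Y :=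
  fun y => if excluded_middle_informative (R y x) then f y else d.

Lemma cut_below {X Y : Type} (R : X -> X -> Prop) (d : Y) x f y :
  R y x -> cut R d x f y = f y.
Proof.
  intros H; unfold cut; destruct (excluded_middle_informative _); tauto.
Qed.

(** The step function sees a total function that returns [d] off the predecessors of [x]. Unfolding
    is then a plain equation through [cut], without accessibility proofs in the recursive calls. *)
Definition wfrec {X Y : Type} {R : X -> X -> Prop} (Hwf : well_founded R) (d : Y)
    (G : X -> (X -> Y) -> Y) : X -> Y :=
  Fix Hwf (fun _ => Y) (fun x rec =>
    G x (fun y => match excluded_middle_informative (R y x) with
                  | left h => rec y h | right _ => d end)).

Lemma wfrec_eq {X Y : Type} {R : X -> X -> Prop} (Hwf : well_founded R) (d : Y)
    (G : X -> (X -> Y) -> Y) x :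
  wfrec Hwf d G x = G x (cut R d x (wfrec Hwf d G)).
Proof.
  unfold wfrec at 1. rewrite Fix_eq.
  - reflexivity.
  - clear. intros x f g Hfg. f_equal. apply functional_extensionality; intros y.
    destruct (excluded_middle_informative _); auto.
Qed.

Definition prod_set {X Y : Type} (A : X -> Prop) (B : Y -> Prop) : X * Y -> Prop :=
  fun p => A (fst p) /\ B (snd p).

Lemma le_card_trans {X Y Z : Type} (A : X -> Prop) (B : Y -> Prop) (C : Z -> Prop) :
  le_card A B -> le_card B C -> le_card A C.
Proof.
  intros (f & Hf & If) (g & Hg & Ig). exists (fun x => g (f x)). split; auto.
Qed.

Lemma le_card_incl {X : Type} (A B : X -> Prop) :
  (forall x, A x -> B x) -> le_card A B.
Proof. intros H. exists (fun x => x). auto. Qed.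

(** Distinct elements of [A] share no related value, so any selector obtained by choice is
    injective; [y0] is its value off [A]. *)
Lemma le_card_rel {X Y : Type} (A : X -> Prop) (B : Y -> Prop) (y0 : Y)
    (R : X -> Y -> Prop) :
  (forall x, A x -> exists y, B y /\ R x y) ->
  (forall x x' y, A x -> A x' -> R x y -> R x' y -> x = x') ->
  le_card A B.
Proof.
  intros Htot Hinj.
  assert (E : forall x, exists y, A x -> B y /\ R x y).
  { intros x. destruct (classic (A x)) as [H|H].
    - destruct (Htot x H) as (y & Hy). exists y; auto.
    - exists y0; tauto. }
  apply choice in E. destruct E as (f & Hf). exists f. split.
  - intros x Hx. apply (Hf x Hx).
  - intros x x' Hx Hx' Heq. apply (Hinj x x' (f x)); auto.
    + apply (Hf x Hx).
    + rewrite Heq. apply (Hf x' Hx').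
Qed.

Lemma le_card_surj {X Y : Type} (A : X -> Prop) (B : Y -> Prop) (y0 : Y) (g : Y -> X) :
  (forall x, A x -> exists y, B y /\ g y = x) -> le_card A B.
Proof.
  intros H. apply le_card_rel with (R := fun x y => g y = x); auto.
  intros x x' y _ _ <- <-. reflexivity.
Qed.

Lemma le_card_prod {X X' Y Y' : Type} (A : X -> Prop) (A' : X' -> Prop)
    (B : Y -> Prop) (B' : Y' -> Prop) :
  le_card A A' -> le_card B B' -> le_card (prod_set A B) (prod_set A' B').
Proof.
  intros (f & Hf & If) (g & Hg & Ig).
  exists (fun p => (f (fst p), g (snd p))). split.
  - intros [x y] [H1 H2]. split; simpl in *; auto.
  - intros [x y] [x' y'] [H1 H2] [H3 H4] E. simpl in *. inversion E. f_equal; auto.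
Qed.

Lemma finite_le_card {X Y : Type} (A : X -> Prop) (B : Y -> Prop) :
  le_card A B -> finite_set B -> finite_set A.
Proof.
  intros (f & Hf & If) (s & Hs).
  (* The list for [B] is pulled back: each entry contributes its unique preimage in [A], if there is
     one. *)
  exists (flat_map (fun y =>
    match excluded_middle_informative (exists x, A x /\ f x = y) with
    | left h => proj1_sig (constructive_indefinite_description _ h) :: nil
    | right _ => nil end) s).
  intros x Hx. apply in_flat_map. exists (f x). split; [apply Hs; auto|].
  destruct (excluded_middle_informative _) as [h|h].
  - destruct (constructive_indefinite_description _ h) as (x' & Hx' & E). simpl.
    left. apply If; auto.
  - exfalso. apply h. exists x; auto.
Qed.

Lemma finite_incl {X : Type} (A B : X -> Prop) :
  (forall x, A x -> B x) -> finite_set B -> finite_set A.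
Proof. intros H [s Hs]. exists s; auto. Qed.

Lemma finite_union {X : Type} (A B : X -> Prop) :
  finite_set A -> finite_set B -> finite_set (fun x => A x \/ B x).
Proof.
  intros [s Hs] [t Ht]. exists (s ++ t). intros x [H|H]; apply in_or_app; auto.
Qed.

Lemma finite_prod {X Y : Type} (A : X -> Prop) (B : Y -> Prop) :
  finite_set A -> finite_set B -> finite_set (prod_set A B).
Proof.
  intros [s Hs] [t Ht]. exists (list_prod s t). intros [x y] [H1 H2].
  apply in_prod; auto.
Qed.

Definition infinite {X : Type} (A : X -> Prop) : Prop :=
  le_card (fun _ : nat => True) A.

Lemma infinite_not_finite {X : Type} (A : X -> Prop) : infinite A -> ~ finite_set A.
Proof.
  intros H Hf. destruct (finite_le_card H Hf) as [s Hs].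
  assert (B : forall n, In n s -> n <= list_max s).
  { intros n Hn. assert (F := proj1 (list_max_le s (list_max s)) (le_n _)).
    rewrite Forall_forall in F. auto. }
  specialize (B _ (Hs (S (list_max s)) I)). lia.
Qed.

Lemma finite_nat_below (n : nat) : finite_set (fun m => m < n).
Proof. exists (seq 0 n). intros m Hm. apply in_seq. lia. Qed.

(* Send [p] to the first point of [I] not yet used; there is one because the points
   used so far are fewer than [I]. *)
Lemma le_card_wf {X Y : Type} (R : X -> X -> Prop) (P : X -> Prop) (I : Y -> Prop) (y0 : Y) :
  well_founded R ->
  (forall x y, P x -> P y -> R x y \/ x = y \/ R y x) ->
  (forall p, P p -> ~ le_card I (fun q => P q /\ R q p)) ->
  le_card P I.
Proof.
  intros Hwf Htot Hsmall.
  set (fresh := fun p (g : X -> Y) y => I y /\ forall q, P q -> R q p -> g q <> y).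
  set (G := wfrec Hwf y0 (fun p g => epsilon (inhabits y0) (fresh p g))).
  assert (HG : forall p, P p -> fresh p G (G p)).
  { intros p Hp.
    assert (E : fresh p (cut R y0 p G) (G p)).
    { unfold G at 2. rewrite wfrec_eq. fold G. apply epsilon_spec.
      apply NNPP. intros N. apply (Hsmall p Hp).
      apply le_card_rel with (R := fun y q => G q = y); [exact p| |].
      - intros y Hy. apply NNPP. intros M. apply N. exists y. split; auto.
        intros q Hq Hqp Eq. apply M. exists q. repeat split; auto.
        rewrite <- Eq. symmetry. apply cut_below; auto.
      - intros y y' q _ _ <- <-. reflexivity. }
    destruct E as [E1 E2]. split; auto.
    intros q Hq Hqp. specialize (E2 q Hq Hqp). rewrite cut_below in E2; auto. }
  exists G. split.
  - intros p Hp. apply (HG p Hp).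
  - intros p q Hp Hq E. destruct (Htot p q Hp Hq) as [H|[H|H]]; auto; exfalso.
    + apply (proj2 (HG q Hq) p Hp H E).
    + apply (proj2 (HG p Hp) q Hq H). auto.
Qed.

(** [le_card_wf] applies with source [nat]: its hypothesis could fail only if [A] embedded into the
    numbers below some [n], and then [A] would be finite. *)
Lemma finite_or_infinite {X : Type} (A : X -> Prop) : finite_set A \/ infinite A.
Proof.
  destruct (classic (finite_set A)) as [H|H]; [auto|right].
  assert (x0 : inhabited X).
  { apply NNPP. intros N. apply H. exists nil. intros x. exfalso. apply N.
    exact (inhabits x). }
  destruct x0 as [x0].
  apply le_card_wf with (R := Nat.lt); auto.
  - exact lt_wf.
  - intros x y _ _. destruct (Nat.lt_trichotomy x y) as [?|[?|?]]; auto.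
  - intros n _ L. apply H. apply (finite_le_card L).
    apply finite_incl with (B := fun m => m < n); [tauto|apply finite_nat_below].
Qed.

Lemma infinite_mono {X Y : Type} (A : X -> Prop) (B : Y -> Prop) :
  infinite A -> le_card A B -> infinite B.
Proof. apply le_card_trans. Qed.

(** Hilbert's hotel: [x0] goes to [h 0], every other [h n] to [h (S n)], and the remaining points
    stay fixed. *)
Lemma infinite_add_point {X : Type} (A : X -> Prop) (x0 : X) :
  infinite A -> le_card (fun x => A x \/ x = x0) A.
Proof.
  intros (h & Hh & Ih).
  apply le_card_rel with (R := fun x y =>
    (x = x0 /\ y = h 0) \/
    (x <> x0 /\ exists n, x = h n /\ y = h (S n)) \/
    (x <> x0 /\ (forall n, x <> h n) /\ y = x)); auto.
  - intros x Hx. destruct (classic (x = x0)) as [E|E].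
    { exists (h 0). split; auto. }
    destruct (classic (exists n, x = h n)) as [[n Hn]|N].
    + exists (h (S n)). split; auto. right; left. split; eauto.
    + exists x. split; [tauto|]. right; right. repeat split; auto.
      intros n Hn. apply N; eauto.
  - assert (J : forall m n, h m = h n -> m = n) by (intros; apply Ih; auto).
    intros x x' y _ _ [[E1 E2]|[(E1 & n & E2 & E3)|(E1 & E2 & E3)]]
      [[F1 F2]|[(F1 & m & F2 & F3)|(F1 & F2 & F3)]]; subst; auto.
    + apply J in F3. discriminate.
    + exfalso. apply (F2 0); auto.
    + apply J in F2. discriminate.
    + apply J in F3. inversion F3. reflexivity.
    + exfalso. eapply F2; eauto.
    + exfalso. eapply E2; eauto.
    + exfalso. eapply E2; eauto.
Qed.

(** * Well-orders and squares of infinite sets *)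

Section WellOrder.
Variables (K : Type) (lt : K -> K -> Prop).
Hypothesis Hwo : strict_wellorder lt.

Local Notation "a << b" := (lt a b) (at level 70).

Lemma lt_irr a : ~ a << a.
Proof. apply Hwo. Qed.
Lemma lt_tr a b c : a << b -> b << c -> a << c.
Proof. apply Hwo. Qed.
Lemma lt_tri a b : a << b \/ a = b \/ b << a.
Proof. apply Hwo. Qed.
Lemma wo_wf : well_founded lt.
Proof. apply Hwo. Qed.
Lemma lt_asym a b : a << b -> ~ b << a.
Proof. intros H H'. exact (lt_irr (lt_tr H H')). Qed.
Lemma le_nlt a b : le lt a b <-> ~ b << a.
Proof.
  split.
  - intros [H| ->]; [apply lt_asym; auto|apply lt_irr].
  - intros H. destruct (lt_tri a b) as [?|[?|?]]; unfold le; tauto.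
Qed.
Lemma le_lt_tr a b c : le lt a b -> b << c -> a << c.
Proof. intros [H| ->]; auto. intros; eapply lt_tr; eauto. Qed.
Lemma lt_le_tr a b c : a << b -> le lt b c -> a << c.
Proof. intros H [H'| <-]; auto. eapply lt_tr; eauto. Qed.
Lemma le_tr a b c : le lt a b -> le lt b c -> le lt a c.
Proof. intros H [H'| <-]; auto. left. eapply le_lt_tr; eauto. Qed.

Lemma least (P : K -> Prop) :
  (exists a, P a) -> exists a, P a /\ forall b, P b -> le lt a b.
Proof.
  intros [a Ha]. apply NNPP. intros N.
  induction a as [a IH] using (well_founded_ind wo_wf).
  apply N. exists a. split; auto. intros b Hb. apply le_nlt. intros L. eapply IH; eauto.
Qed.

Definition downclosed (I : K -> Prop) : Prop := forall a b, I a -> b << a -> I b.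

Definition maxK (a b : K) : K := if excluded_middle_informative (a << b) then b else a.

Lemma maxK_l a b : le lt a (maxK a b).
Proof.
  unfold maxK. destruct (excluded_middle_informative _); [left|right]; auto.
Qed.
Lemma maxK_r a b : le lt b (maxK a b).
Proof.
  unfold maxK. destruct (excluded_middle_informative _); [right; auto|].
  apply le_nlt; auto.
Qed.
Lemma maxK_ind (P : K -> Prop) a b : P a -> P b -> P (maxK a b).
Proof. unfold maxK. destruct (excluded_middle_informative _); auto. Qed.

(* Goedel's order on pairs: every proper initial segment lies in a square. *)
Definition godel (p q : K * K) : Prop :=
  let m := maxK (fst p) (snd p) in let n := maxK (fst q) (snd q) in
  m << n \/ (m = n /\ (fst p << fst q \/ (fst p = fst q /\ snd p << snd q))).

Lemma godel_wf : well_founded godel.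
Proof.
  assert (H : forall m x y, maxK x y = m -> Acc godel (x, y)).
  { intros m. induction m as [m IHm] using (well_founded_ind wo_wf).
    intros x. induction x as [x IHx] using (well_founded_ind wo_wf).
    intros y. induction y as [y IHy] using (well_founded_ind wo_wf).
    intros E. constructor. intros [x' y'] [H|(H1 & [H2|[H2 H3]])]; simpl in *.
    - rewrite E in H. eapply IHm; eauto.
    - apply (IHx x' H2). congruence.
    - subst x'. apply (IHy y' H3). congruence. }
  intros [x y]. eapply H; eauto.
Qed.

Lemma godel_total p q : godel p q \/ p = q \/ godel q p.
Proof.
  destruct p as [x y], q as [x' y']. unfold godel; simpl.
  destruct (lt_tri (maxK x y) (maxK x' y')) as [?|[E|?]]; auto.
  destruct (lt_tri x x') as [?|[Ex|?]]; auto 6.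
  destruct (lt_tri y y') as [?|[Ey|?]]; auto 8. subst; auto.
Qed.

(** Hessenberg's argument, without naming cardinals. If [I] embeds into a proper initial segment,
    the square of that segment is handled by hypothesis. Otherwise [I] behaves like an initial
    ordinal: a proper Goedel segment lies in the square of some [m + 1], which is finite or no
    larger than [m], so [I] does not embed into it and [le_card_wf] applies. *)
Lemma square_step (I : K -> Prop) :
  downclosed I ->
  (forall m, I m -> infinite (fun b => b << m) ->
     le_card (prod_set (fun b => b << m) (fun b => b << m)) (fun b => b << m)) ->
  infinite I -> le_card (prod_set I I) I.
Proof.
  intros HI IH Hinf.
  destruct (classic (exists m, I m /\ le_card I (fun b => b << m))) as [(m & Hm & Lm)|N].
  { assert (J : infinite (fun b => b << m)) by (eapply infinite_mono; eauto).
    apply le_card_trans with (B := prod_set (fun b => b << m) (fun b => b << m)).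
    { apply le_card_prod; auto. }
    eapply le_card_trans; [apply IH; auto|].
    apply le_card_incl. intros b; apply HI; auto. }
  assert (k0 : inhabited K) by (destruct Hinf as [h _]; exact (inhabits (h 0))).
  destruct k0 as [k0].
  apply le_card_wf with (R := godel); auto.
  { exact godel_wf. }
  { intros; apply godel_total. }
  intros [x y] [Hx Hy] L. simpl in Hx, Hy.
  set (m := maxK x y) in *.
  assert (Hm : I m) by (apply maxK_ind; auto).
  assert (Hsq : le_card I (prod_set (fun b => b << m \/ b = m) (fun b => b << m \/ b = m))).
  { apply (le_card_trans L). apply le_card_incl. intros [x' y'] [_ G].
    unfold godel in G; simpl in G. fold m in G.
    assert (G' : le lt (maxK x' y') m) by (unfold le; tauto).
    split; simpl; [apply (le_tr (maxK_l x' y') G')|apply (le_tr (maxK_r x' y') G')]. }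
  destruct (finite_or_infinite (fun b => b << m)) as [F|F].
  - assert (F' : finite_set (fun b => b << m \/ b = m)).
    { apply finite_union; auto. exists (m :: nil). intros; subst; simpl; auto. }
    exact (infinite_not_finite (infinite_mono Hinf Hsq) (finite_prod F' F')).
  - apply N. exists m. split; auto.
    apply (le_card_trans Hsq).
    apply le_card_trans with (B := prod_set (fun b => b << m) (fun b => b << m)); auto.
    apply le_card_prod; apply infinite_add_point; auto.
Qed.

Lemma square_le (I : K -> Prop) :
  downclosed I -> infinite I -> le_card (prod_set I I) I.
Proof.
  intros HI. apply square_step; auto. intros m _. clear I HI.
  induction m as [m IH] using (well_founded_ind wo_wf).
  apply square_step; auto. intros a b; simpl. intros; eapply lt_tr; eauto.
Qed.

End WellOrder.

(** * Regular uncountable cardinals *)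

Section Regular.
Variables (K : Type) (lt : K -> K -> Prop).
Hypothesis Hwo : strict_wellorder lt.
Hypothesis Hreg : regular lt.
Hypothesis Hunc : uncountable K.

Local Notation "a << b" := (lt a b) (at level 70).
Local Notation "a <<= b" := (le lt a b) (at level 70).

Lemma inhabited_K : inhabited K.
Proof.
  apply NNPP. intros N. apply Hunc. exists (fun _ => 0). split; auto.
  intros x. exfalso. exact (N (inhabits x)).
Qed.

Lemma bounded_of_le_segment (S : K -> Prop) a :
  le_card S (fun b => b << a) -> exists u, forall s, S s -> s << u.
Proof.
  intros L. apply NNPP. intros N. apply (Hreg (A := S)); [|eauto].
  intros u. apply NNPP. intros M. apply N. exists u. intros s Hs.
  apply NNPP. intros E. apply M. exists s. split; auto. apply (le_nlt Hwo); auto.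
Qed.

(** If a maximum [a] has something below it, the cofinal singleton of [a] embeds below [a], against
    regularity; if not, [K] is a single point, against uncountability. *)
Lemma no_max a : exists b, a << b.
Proof.
  apply NNPP. intros N.
  assert (T : forall b, b <<= a).
  { intros b. apply (le_nlt Hwo). eauto. }
  destruct (classic (exists b, b << a)) as [[b Hb]|M].
  - destruct (@bounded_of_le_segment (fun x => x = a) a) as [u Hu].
    + exists (fun _ => b). split; [auto|]. intros; subst; auto.
    + apply N. eauto.
  - apply Hunc. exists (fun _ => 0). split; auto. intros x y _ _ _.
    destruct (T x) as [?| ->]; [exfalso; eauto|].
    destruct (T y) as [?| ->]; [exfalso; eauto|reflexivity].
Qed.

Definition is_succ (a b : K) : Prop := a << b /\ forall c, a << c -> b <<= c.

Definition succ (a : K) : K := epsilon (inhabits a) (is_succ a).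

Lemma succ_spec a : is_succ a (succ a).
Proof.
  unfold succ. apply epsilon_spec. destruct (least Hwo (no_max a)) as (b & H1 & H2). exists b; split; auto.
Qed.

Lemma lt_succ a : a << succ a.
Proof. apply succ_spec. Qed.

Lemma lt_succ_le a b : b << succ a <-> b <<= a.
Proof.
  split.
  - intros H. apply (le_nlt Hwo). intros L. apply (proj2 (succ_spec a)) in L.
    exact (lt_irr Hwo (lt_le_tr Hwo H L)).
  - intros H. apply (le_lt_tr Hwo H). apply lt_succ.
Qed.

Lemma succ_inj a b : succ a = succ b -> a = b.
Proof.
  intros E.
  assert (H1 : a <<= b) by (apply lt_succ_le; rewrite <- E; apply lt_succ).
  assert (H2 : b <<= a) by (apply lt_succ_le; rewrite E; apply lt_succ).
  destruct H1 as [H1|H1]; auto. destruct H2 as [H2|H2]; auto.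
  exfalso; exact (lt_asym Hwo H1 H2).
Qed.

Lemma zero_succ_limit a :
  (forall b, ~ b << a) \/ (exists b, a = succ b) \/ is_limit lt a.
Proof.
  destruct (classic (exists b, b << a)) as [H|H]; [|left; intros b Hb; eauto].
  right. destruct (classic (forall b, b << a -> exists g, b << g /\ g << a)) as [L|L].
  - right. split; auto.
  - left. apply not_all_ex_not in L. destruct L as [b L]. apply imply_to_and in L.
    destruct L as [Hb L]. exists b.
    destruct (proj2 (succ_spec b) a Hb) as [E|E]; auto.
    exfalso. apply L. exists (succ b). split; auto. apply lt_succ.
Qed.

Lemma succ_not_limit a : ~ is_limit lt (succ a).
Proof.
  intros [_ H]. destruct (H a (lt_succ a)) as (g & H1 & H2).
  apply lt_succ_le in H2. apply (le_nlt Hwo) in H2. auto.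
Qed.

Lemma limit_succ a b : is_limit lt a -> b << a -> succ b << a.
Proof.
  intros [_ H] Hb. destruct (H b Hb) as (g & H1 & H2).
  apply (le_lt_tr Hwo) with (b := g); auto. apply succ_spec; auto.
Qed.

Definition fin (i : K) : Prop := finite_set (fun g => g << i).

(* The ordinal [max(omega, a)]. *)
Definition max_omega (a i : K) : Prop := i << a \/ fin i.

Local Notation M := max_omega.

Lemma fin_downclosed : downclosed lt fin.
Proof.
  intros a b Ha Hb. apply (finite_incl (B := fun g => g << a)); auto.
  intros x Hx; eapply lt_tr; eauto.
Qed.

Lemma max_omega_downclosed a : downclosed lt (M a).
Proof.
  intros i j [H|H] Hj; [left; eapply lt_tr; eauto|right; eapply fin_downclosed; eauto].
Qed.

Lemma infinite_K : infinite (fun _ : K => True).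
Proof.
  destruct (finite_or_infinite (fun _ : K => True)) as [[s Hs]|H]; auto.
  exfalso. apply Hunc.
  destruct inhabited_K as [k0].
  apply le_card_surj with (g := fun n => nth n s k0); [exact 0|].
  intros x _. destruct (In_nth s x k0 (Hs x I)) as (n & _ & E). exists n; auto.
Qed.

(** If the finite ordinals formed a finite set, the least ordinal that is not finite would have only
    finitely many predecessors; and if all ordinals were finite, [K] itself would be a finite
    set. *)
Lemma infinite_fin : infinite fin.
Proof.
  destruct (finite_or_infinite fin) as [H|H]; auto. exfalso.
  destruct (classic (exists k, ~ fin k)) as [E|E].
  - destruct (least Hwo E) as (k & Hk & Hmin). apply Hk.
    apply (finite_incl (B := fin)); auto. intros b Hb. apply NNPP. intros N.
    apply Hmin in N. apply (le_nlt Hwo) in N. auto.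
  - apply (infinite_not_finite infinite_K).
    apply (finite_incl (B := fin)); auto. intros x _. apply NNPP. eauto.
Qed.

Lemma fin_countable : le_card fin (fun _ : nat => True).
Proof.
  apply le_card_wf with (R := lt); [exact 0|apply wo_wf; auto| |].
  - intros; apply (lt_tri Hwo).
  - intros p Hp H. apply (infinite_not_finite H).
    apply (finite_incl (B := fun g => g << p)); auto. tauto.
Qed.

Lemma exists_not_fin : exists w, ~ fin w.
Proof.
  apply NNPP. intros N. apply Hunc.
  apply le_card_trans with (B := fin); [|exact fin_countable].
  apply le_card_incl. intros x _. apply NNPP. eauto.
Qed.

Lemma infinite_max_omega a : infinite (M a).
Proof.
  apply (infinite_mono infinite_fin). apply le_card_incl. unfold max_omega; auto.
Qed.

Lemma max_omega_square a : le_card (prod_set (M a) (M a)) (M a).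
Proof. apply (square_le Hwo); [apply max_omega_downclosed|apply infinite_max_omega]. Qed.

Lemma max_omega_mono a b : a <<= b -> le_card (M a) (M b).
Proof.
  intros H. apply le_card_incl. intros i [L|L]; [left|right]; auto.
  apply (lt_le_tr Hwo L H).
Qed.

Lemma max_omega_succ a : le_card (M (succ a)) (M a).
Proof.
  apply le_card_trans with (B := fun x => M a x \/ x = a).
  - apply le_card_incl. intros i [H|H]; [|left; right; auto].
    apply lt_succ_le in H. destruct H as [H|H]; [left; left; auto|auto].
  - apply infinite_add_point. apply infinite_max_omega.
Qed.

Lemma nat_le_max_omega a : le_card (fun _ : nat => True) (M a).
Proof. apply infinite_max_omega. Qed.

Definition segment_plus_nat (a : K) : K + nat -> Prop :=
  fun s => match s with inl b => lt b a | inr _ => True end.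

Lemma max_omega_le_sum a : le_card (M a) (segment_plus_nat a).
Proof.
  destruct fin_countable as (h & _ & Ih).
  exists (fun i => if excluded_middle_informative (i << a) then inl i else inr (h i)).
  split.
  - intros i Hi. destruct (excluded_middle_informative _); simpl; auto.
  - intros i j Hi Hj. unfold max_omega in *.
    repeat destruct (excluded_middle_informative _); intros E; inversion E; auto.
    apply Ih; tauto.
Qed.

Lemma sum_le_max_omega {X Y : Type} (A : X -> Prop) (B : Y -> Prop) a :
  le_card A (M a) -> le_card B (M a) ->
  le_card (fun s : X + Y => match s with inl x => A x | inr y => B y end) (M a).
Proof.
  intros (f & Hf & If) (g & Hg & Ig).
  eapply le_card_trans; [|apply max_omega_square].
  destruct (infinite_max_omega a) as (h & Hh & Ih).
  exists (fun s => match s with inl x => (h 0, f x) | inr y => (h 1, g y) end).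
  assert (N : h 0 <> h 1) by (intros E; apply Ih in E; auto; discriminate).
  split.
  - intros [x|y] H; split; simpl; auto.
  - intros [x|y] [x'|y'] H H' E; inversion E; try congruence; f_equal; auto.
Qed.

Lemma segment_plus_nat_le_max_omega a : le_card (segment_plus_nat a) (M a).
Proof.
  apply (sum_le_max_omega (A := fun b => b << a) (B := fun _ : nat => True)).
  - apply le_card_incl. unfold max_omega; auto.
  - apply nat_le_max_omega.
Qed.

(** Regularity is stated for initial segments; placing [M a] inside one makes it available for sets
    of size at most that of [M a]. *)
Lemma max_omega_segment a : exists w, forall i, M a i -> i << w.
Proof.
  destruct exists_not_fin as [w Hw]. exists (maxK lt a w). intros i [H|H].
  - apply (lt_le_tr Hwo H). apply maxK_l.
  - apply (lt_le_tr Hwo (b := w)); [|apply (maxK_r Hwo)].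
    destruct (lt_tri Hwo i w) as [L|[->|L]]; [auto|tauto|].
    exfalso. apply Hw. eapply fin_downclosed; eauto.
Qed.

Lemma bounded_of_le_max_omega (S : K -> Prop) a :
  le_card S (M a) -> exists u, forall s, S s -> s << u.
Proof.
  intros L. destruct (max_omega_segment a) as [w Hw].
  apply bounded_of_le_segment with (a := w).
  apply (le_card_trans L). apply le_card_incl; auto.
Qed.

Lemma not_K_le_max_omega a : ~ le_card (fun _ : K => True) (M a).
Proof.
  intros L. destruct (bounded_of_le_max_omega L) as [u Hu]. exact (lt_irr Hwo (Hu u I)).
Qed.

Lemma bounded_image {X : Type} (x0 : X) (A : X -> Prop) (g : X -> K) a :
  le_card A (M a) -> exists u, forall x, A x -> g x << u.
Proof.
  intros L. destruct (bounded_of_le_max_omega (S := fun k => exists x, A x /\ g x = k) (a := a))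
    as [u Hu].
  - apply (fun H => le_card_trans H L). apply le_card_surj with (g := g); auto.
  - exists u. intros x Hx. apply Hu. eauto.
Qed.

(** The first conjunct excludes zero, where closure would hold vacuously. *)
Definition closed_under (g : K -> K) (b : K) : Prop :=
  (exists a, a << b) /\ forall a, a << b -> g a << b.

Lemma club_closed_under (g : K -> K) : club lt (closed_under g).
Proof.
  split.
  - intros a.
    (* The next iterate has to exceed [x] and all values of [g] up to [x]; the bound exists by
       regularity. *)
    assert (N : forall x, exists z, x << z /\ forall y, y <<= x -> g y << z).
    { intros x. destruct (bounded_image x (A := fun y => y <<= x) g (a := succ x)) as [u Hu].
      - apply le_card_incl. intros y Hy. left. apply lt_succ_le; auto.
      - exists (maxK lt (succ x) u). split.
        + apply (lt_le_tr Hwo (lt_succ x)). apply maxK_l.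
        + intros y Hy. apply (lt_le_tr Hwo (Hu y Hy)). apply (maxK_r Hwo). }
    apply choice in N. destruct N as [nxt Hnxt].
    set (s := fun n => Nat.iter n nxt a).
    assert (Hs : forall n, s n << s (S n)) by (intros n; apply Hnxt).
    destruct (bounded_image 0 (A := fun _ => True) s (nat_le_max_omega a)) as [u Hu].
    (* Leastness of the strict upper bound makes the iterates cofinal in [b], so every [x << b] is
       caught by some iterate and [g x] by the following one. *)
    destruct (least Hwo (P := fun u => forall n, s n << u)) as (b & Hb & Hmin).
    { exists u; auto. }
    assert (Hab : a << b) by exact (Hb 0).
    exists b. split; [split; eauto|exact Hab].
    intros x Hx.
    assert (E : exists n, x <<= s n).
    { apply NNPP. intros N. apply (proj1 (le_nlt Hwo b x)); [|exact Hx].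
      apply Hmin. intros n. apply NNPP. intros L. apply N. exists n.
      apply (le_nlt Hwo); auto. }
    destruct E as [n Hn]. apply (lt_tr Hwo) with (b := s (S n)); [|apply Hb].
    apply Hnxt; auto.
  - intros b Hb [_ Hsup]. split; auto. intros a Ha.
    destruct (Hsup a Ha) as (c & [[_ Hc] Hcb] & Hac).
    apply (lt_tr Hwo) with (b := c); auto.
Qed.

(** Limits are exactly the nonzero closure points of [succ]. *)
Lemma club_limit : club lt (is_limit lt).
Proof.
  assert (E : forall b, closed_under succ b <-> is_limit lt b).
  { intros b. split.
    - intros [H1 H2]. split; auto. intros x Hx. exists (succ x). split; auto. apply lt_succ.
    - intros H. split; [apply H|]. intros; apply limit_succ; auto. }
  destruct (club_closed_under succ) as [H1 H2]. split.
  - intros a. destruct (H1 a) as (b & Hb & L). exists b. split; auto. apply E; auto.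
  - intros b Hb Hsup. apply E, H2; auto. destruct Hsup as [S1 S2]. split.
    + intros x [Hx L]. apply S1. split; auto. apply E; auto.
    + intros x Hx. destruct (S2 x Hx) as (c & [Hc L] & L'). exists c. repeat split; auto; apply E; auto.
Qed.
End Regular.

(** * Nodes and branches along a club *)

Lemma ext_pred {X : Type} (P Q : X -> Prop) : (forall x, P x <-> Q x) -> P = Q.
Proof.
  intros H. apply functional_extensionality; intros x.
  apply propositional_extensionality; auto.
Qed.

Section Nodes.
Variables (K : Type) (lt : K -> K -> Prop).
Hypothesis Hwo : strict_wellorder lt.

Local Notation "a << b" := (lt a b) (at level 70).
Local Notation "a <<= b" := (le lt a b) (at level 70).

(** Inclusion of graphs, which mentions no domains and allows equality; [sub_incl] recovers [sub]
    once the heights are known. *)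
Definition incl (x y : node K) : Prop := forall g v, x g = Some v -> y g = Some v.

Lemma incl_refl x : incl x x.
Proof. intros g v; auto. Qed.
Lemma incl_trans x y z : incl x y -> incl y z -> incl x z.
Proof. intros H H' g v E; auto. Qed.

Lemma dom_some x a g : hasdom lt x a -> g << a -> exists v, x g = Some v.
Proof.
  intros H L. apply H in L. destruct (x g) as [v|]; [eauto|congruence].
Qed.

Lemma dom_none x a g : hasdom lt x a -> ~ g << a -> x g = None.
Proof.
  intros H L. destruct (x g) eqn:E; auto. exfalso. apply L, H. congruence.
Qed.

Lemma some_dom x a g v : hasdom lt x a -> x g = Some v -> g << a.
Proof. intros H E. apply H. congruence. Qed.

Lemma hasdom_le x y a b : hasdom lt x a -> hasdom lt y b -> incl x y -> a <<= b.
Proof.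
  intros Hx Hy H. apply (le_nlt Hwo). intros L.
  destruct (dom_some Hx L) as [v E]. apply H in E.
  exact (lt_irr Hwo (some_dom Hy E)).
Qed.

Lemma hasdom_unique x a b : hasdom lt x a -> hasdom lt x b -> a = b.
Proof.
  intros Hx Hy.
  destruct (hasdom_le Hx Hy (@incl_refl x)) as [L|]; auto.
  destruct (hasdom_le Hy Hx (@incl_refl x)) as [L'|]; auto.
  exfalso; exact (lt_asym Hwo L L').
Qed.

Lemma incl_eq x y a : hasdom lt x a -> hasdom lt y a -> incl x y -> x = y.
Proof.
  intros Hx Hy H. apply functional_extensionality; intros g.
  destruct (classic (g << a)) as [L|L].
  - destruct (dom_some Hx L) as [v E]. rewrite E. symmetry. auto.
  - rewrite (dom_none Hx L), (dom_none Hy L). reflexivity.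
Qed.

Lemma incl_common x y z a b :
  hasdom lt x a -> hasdom lt y b -> a <<= b -> incl x z -> incl y z -> incl x y.
Proof.
  intros Hx Hy Hab Hxz Hyz g v E.
  destruct (dom_some Hy (lt_le_tr Hwo (some_dom Hx E) Hab)) as [w E'].
  rewrite E'. apply Hxz in E. apply Hyz in E'. congruence.
Qed.

Lemma incl_common_eq x y z a :
  hasdom lt x a -> hasdom lt y a -> incl x z -> incl y z -> x = y.
Proof.
  intros Hx Hy Hxz Hyz. apply (incl_eq Hx Hy).
  apply (incl_common Hx Hy (or_intror eq_refl) Hxz Hyz).
Qed.

Lemma sub_incl x y a b :
  hasdom lt x a -> hasdom lt y b -> a << b -> incl x y -> sub lt x y.
Proof.
  intros Hx Hy L H. exists a, b. repeat split; auto; try apply Hx; try apply Hy.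
  intros g Hg. destruct (dom_some Hx Hg) as [v E]. rewrite E. symmetry; auto.
Qed.

Lemma incl_sub x y : sub lt x y -> incl x y.
Proof.
  intros (a & b & Hx & Hy & L & H) g v E. rewrite <- H; auto.
  apply (some_dom Hx E).
Qed.

Lemma restr_hasdom x a b : hasdom lt x a -> b <<= a -> hasdom lt (restr lt x b) b.
Proof.
  intros Hx L g. unfold restr. destruct (excluded_middle_informative _) as [H|H].
  - split; auto. intros _. apply Hx. apply (lt_le_tr Hwo H L).
  - tauto.
Qed.

Lemma restr_incl x b : incl (restr lt x b) x.
Proof.
  intros g v. unfold restr. destruct (excluded_middle_informative _); congruence.
Qed.

Lemma restr_eq x y a : hasdom lt x a -> incl x y -> restr lt y a = x.
Proof.
  intros Hx H. apply functional_extensionality; intros g. unfold restr.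
  destruct (excluded_middle_informative _) as [L|L].
  - destruct (dom_some Hx L) as [v E]. rewrite E. auto.
  - symmetry. apply (dom_none Hx L).
Qed.

Lemma restr_restr x a b : b <<= a -> restr lt (restr lt x a) b = restr lt x b.
Proof.
  intros L. apply functional_extensionality; intros g. unfold restr.
  destruct (excluded_middle_informative (g << b)) as [H|H]; auto.
  destruct (excluded_middle_informative _) as [H'|H']; auto.
  exfalso. apply H'. apply (lt_le_tr Hwo H L).
Qed.

Lemma brestr_hasdom (f : K -> K) b : hasdom lt (brestr lt f b) b.
Proof.
  intros g. unfold brestr. destruct (excluded_middle_informative _); split; intros;
    try tauto; congruence.
Qed.

Lemma ext_hasdom x a b i : is_succ lt a b -> hasdom lt x a -> hasdom lt (ext x a i) b.
Proof.
  intros [L Hs] Hx g. unfold ext. destruct (excluded_middle_informative _) as [->|N].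
  - split; intros; [auto|congruence].
  - rewrite (Hx g). split; intros H.
    + eapply lt_tr; eauto.
    + destruct (lt_tri Hwo g a) as [?|[?|G]]; [auto|congruence|].
      exfalso. apply Hs in G. apply (le_nlt Hwo) in G. auto.
Qed.

Lemma ext_incl x a i : hasdom lt x a -> incl x (ext x a i).
Proof.
  intros Hx g v E. unfold ext. destruct (excluded_middle_informative _) as [->|N]; auto.
  exfalso. exact (lt_irr Hwo (some_dom Hx E)).
Qed.

Lemma ext_at (x : node K) a i : ext x a i a = Some i.
Proof. unfold ext. destruct (excluded_middle_informative _); congruence. Qed.

Lemma ext_inj x y a i j :
  hasdom lt x a -> hasdom lt y a -> ext x a i = ext y a j -> x = y /\ i = j.
Proof.
  intros Hx Hy E. split.
  - apply (incl_common_eq (z := ext x a i) Hx Hy); [apply ext_incl; auto|].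
    rewrite E. apply ext_incl; auto.
  - assert (E' := f_equal (fun h => h a) E). cbv beta in E'.
    rewrite !ext_at in E'. congruence.
Qed.

Definition empty_node : node K := fun _ => None.

Lemma empty_hasdom a : (forall b, ~ b << a) -> hasdom lt empty_node a.
Proof. intros H g. split; [intros E; elim E; reflexivity|intros L; elim (H g L)]. Qed.

Lemma hasdom_empty x a : (forall b, ~ b << a) -> hasdom lt x a -> x = empty_node.
Proof.
  intros H Hx. apply functional_extensionality; intros g. apply (dom_none Hx (H g)).
Qed.

(** * Paths along a closed set of heights *)

Definition is_max_below (E : K -> Prop) (b g : K) : Prop :=
  E g /\ g << b /\ forall d, E d -> d << b -> d <<= g.

Lemma is_max_below_unique E b g g' :
  is_max_below E b g -> is_max_below E b g' -> g = g'.
Proof.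
  intros (H1 & H2 & H3) (H1' & H2' & H3').
  destruct (H3 g' H1' H2') as [L|]; auto.
  destruct (H3' g H1 H2) as [L'|]; auto.
  exfalso; exact (lt_asym Hwo L L').
Qed.

Lemma is_max_below_agree E E' b g :
  (forall d, d << b -> (E d <-> E' d)) -> is_max_below E b g -> is_max_below E' b g.
Proof.
  intros H (H1 & H2 & H3). repeat split; auto.
  - apply H; auto.
  - intros d Hd L. apply H3; auto. apply H; auto.
Qed.

(* The position of [b] in its block of consecutive elements of [D]. *)
Definition index (D : K -> Prop) : K -> nat :=
  wfrec (wo_wf Hwo) 0 (fun b idx =>
    if excluded_middle_informative (exists g, is_max_below D b g)
    then S (idx (epsilon (inhabits b) (is_max_below D b))) else 0).

Lemma index_succ D b g : is_max_below D b g -> index D b = S (index D g).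
Proof.
  intros H. unfold index at 1. rewrite wfrec_eq. fold (index D).
  destruct (excluded_middle_informative _) as [E|E]; [|exfalso; eauto].
  assert (E' : epsilon (inhabits b) (is_max_below D b) = g).
  { apply (is_max_below_unique (E := D) (b := b)); auto. apply epsilon_spec; auto. }
  rewrite E', cut_below; auto. apply H.
Qed.

Lemma index_zero D b : ~ (exists g, is_max_below D b g) -> index D b = 0.
Proof.
  intros H. unfold index. rewrite wfrec_eq.
  destruct (excluded_middle_informative _); tauto.
Qed.

Lemma index_agree D D' b :
  (forall d, d << b -> (D d <-> D' d)) -> index D b = index D' b.
Proof.
  induction b as [b IH] using (well_founded_ind (wo_wf Hwo)). intros H.
  assert (H' : forall d, d << b -> (D' d <-> D d)) by (intros d Hd; symmetry; auto).
  destruct (classic (exists g, is_max_below D b g)) as [[g Hg]|N].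
  - rewrite (index_succ Hg), (index_succ (is_max_below_agree H Hg)).
    f_equal. apply IH; [apply Hg|]. intros d Hd. apply H.
    apply (lt_tr Hwo Hd). apply Hg.
  - rewrite (index_zero N), index_zero; auto.
    intros [g Hg]. apply N. exists g. apply (is_max_below_agree H' Hg).
Qed.

(* [path b] starts from [x] at height [a], applies [c] at the successor points of [D]
   above [a], and takes unions elsewhere. *)
Section Path.
Variables (D : K -> Prop) (c : K -> node K -> node K) (a : K) (x : node K).

(** The start is adjoined explicitly because it need not belong to [D]. *)
Definition stage (g : K) : Prop := g = a \/ (D g /\ a << g).

Definition path : K -> node K :=
  wfrec (wo_wf Hwo) empty_node (fun b p =>
    if excluded_middle_informative (b = a) then x
    else if excluded_middle_informative (exists g, is_max_below stage b g)
    then c b (p (epsilon (inhabits b) (is_max_below stage b)))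
    else fun h =>
      let above := fun g => stage g /\ g << b /\ h << g in
      if excluded_middle_informative (exists g, above g)
      then p (epsilon (inhabits b) above) h else None).

Lemma path_start : path a = x.
Proof.
  unfold path. rewrite wfrec_eq. destruct (excluded_middle_informative _); congruence.
Qed.

Lemma stage_ge g : stage g -> a <<= g.
Proof. intros [->|[_ H]]; [right|left]; auto. Qed.

Lemma path_succ b g : is_max_below stage b g -> path b = c b (path g).
Proof.
  intros H. unfold path at 1. rewrite wfrec_eq. fold path.
  destruct (excluded_middle_informative _) as [->|N].
  { destruct H as (H1 & H2 & _). apply stage_ge, (le_nlt Hwo) in H1. tauto. }
  destruct (excluded_middle_informative _) as [E|E]; [|exfalso; eauto].
  assert (E' : epsilon (inhabits b) (is_max_below stage b) = g).
  { apply (is_max_below_unique (E := stage) (b := b)); auto. apply epsilon_spec; auto. }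
  rewrite E', cut_below; auto. apply H.
Qed.

(** The value at [h] is read off an arbitrarily chosen stage between [h] and [b]; [path_spec] shows
    that the choice is immaterial. *)
Lemma path_limit b h :
  b <> a -> ~ (exists g, is_max_below stage b g) ->
  path b h =
    let above := fun g => stage g /\ g << b /\ h << g in
    if excluded_middle_informative (exists g, above g)
    then path (epsilon (inhabits b) above) h else None.
Proof.
  intros N1 N2. unfold path at 1. rewrite wfrec_eq. fold path.
  destruct (excluded_middle_informative _) as [?|_]; [tauto|].
  destruct (excluded_middle_informative _) as [?|_]; [tauto|].
  cbv zeta. destruct (excluded_middle_informative _) as [E|E]; auto.
  rewrite cut_below; auto. apply (epsilon_spec (inhabits b)) in E. apply E.
Qed.

Variables (T : K -> node K -> Prop) (al : K).
Hypothesis HT : forall b t, b << al -> T b t -> hasdom lt t b.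
Hypothesis HD : club_in lt al D.
Hypothesis Ha : a << al.
Hypothesis Hx : T a x.
Hypothesis Hc : forall g b t, g << b -> b << al -> T g t ->
  T b (c b t) /\ incl t (c b t).
(** Limits of stages are the only heights at which a path could leave the tree. In both applications
    this hypothesis is supplied by coherence of [C]. *)
Hypothesis Hacc : forall b, b << al -> a << b -> acc lt D b -> T b (path b).

Lemma stage_cofinal h : h << al -> exists g, stage g /\ g << al /\ h << g.
Proof.
  intros Hh. destruct HD as (D1 & D2 & _).
  destruct (D2 (maxK lt h a)) as (g & Hg & L).
  { apply maxK_ind; auto. }
  exists g. repeat split; auto.
  - right. split; auto. apply (le_lt_tr Hwo (maxK_r Hwo h a) L).
  - apply (le_lt_tr Hwo (maxK_l lt h a) L).
Qed.

(** If the stages below [b] were bounded below [b], their least upper bound [s] would be no stage,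
    as it would then be the immediate predecessor of [b]. So [s] is a limit of points of [D], and
    closedness of [D] makes it a stage after all. *)
Lemma stage_unbounded b :
  b << al -> stage b -> b <> a -> ~ (exists g, is_max_below stage b g) ->
  forall h, h << b -> exists g, stage g /\ g << b /\ h << g.
Proof.
  intros Hb Sb Nb Nmax h Hh. apply NNPP. intros N.
  assert (Hab : a << b) by (destruct Sb as [?|[_ ?]]; [tauto|auto]).
  assert (Hup : forall g, stage g -> g << b -> g <<= h).
  { intros g Sg Hg. apply (le_nlt Hwo). intros L. apply N; eauto. }
  destruct (least Hwo (P := fun s => forall g, stage g -> g << b -> g <<= s))
    as (s & Hs & Hmin); [eauto|].
  assert (Lsb : s << b) by (apply (le_lt_tr Hwo (Hmin h Hup) Hh)).
  assert (Ns : ~ stage s).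
  { intros Ss. apply Nmax. exists s. repeat split; auto. }
  assert (Las : a << s).
  { destruct (Hs a (or_introl eq_refl) Hab) as [?|E]; auto.
    exfalso. apply Ns. left; auto. }
  apply Ns. right. split; auto. apply HD; eauto.
  { apply (lt_tr Hwo Lsb Hb). }
  split.
  - intros e [_ He]. left; auto.
  - intros e He. apply NNPP. intros M.
    apply (proj1 (le_nlt Hwo s (maxK lt e a))).
    + apply Hmin. intros g Sg Hg. apply (le_nlt Hwo). intros L. apply M.
      exists g. repeat split.
      * destruct Sg as [->|[Dg _]]; auto.
        exfalso. apply (lt_irr Hwo (le_lt_tr Hwo (maxK_r Hwo e a) L)).
      * destruct (Hs g Sg Hg) as [?|E]; auto. subst; tauto.
      * apply (le_lt_tr Hwo (maxK_l lt e a) L).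
    + apply maxK_ind; auto.
Qed.

Lemma stage_acc b :
  b << al -> stage b -> b <> a -> ~ (exists g, is_max_below stage b g) -> acc lt D b.
Proof.
  intros Lb Sb Nb N. pose proof (stage_unbounded Lb Sb Nb N) as Hunb.
  destruct Sb as [?|[Db Lab]]; [tauto|].
  split; [auto|]. split; [eauto|]. split.
  - intros d [_ ?]; left; auto.
  - intros d Ld. destruct (Hunb (maxK lt d a)) as (g & Sg & Lg & L).
    { apply maxK_ind; auto. }
    exists g. repeat split; auto.
    + destruct Sg as [->|[? _]]; auto.
      exfalso. apply (lt_irr Hwo (le_lt_tr Hwo (maxK_r Hwo d a) L)).
    + apply (le_lt_tr Hwo (maxK_l lt d a) L).
Qed.

(** Induction along the stages: [Hc] handles those with an immediate predecessor, and at the others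
    the path is an increasing union that lies in the tree by [Hacc]. The height [al] is included
    because the path is finally evaluated there; membership in [T] is not claimed at that point. *)
Lemma path_spec b :
  (stage b /\ b << al) \/ b = al ->
  hasdom lt (path b) b /\ (b << al -> T b (path b)) /\
  forall g, stage g -> g << b -> incl (path g) (path b).
Proof.
  induction b as [b IH] using (well_founded_ind (wo_wf Hwo)). intros Hb.
  assert (Lb : b <<= al) by (destruct Hb as [[_ ?]|?]; [left|right]; auto).
  destruct (classic (b = a)) as [->|Nb].
  { rewrite path_start. repeat split; auto.
    - apply HT; auto.
    - apply HT; auto.
    - intros g Sg L. apply stage_ge, (le_nlt Hwo) in Sg. tauto. }
  destruct (classic (exists g, is_max_below stage b g)) as [[g Hg]|N].
  - assert (Lb' : b << al).
    { destruct Lb as [?|E]; auto. rewrite E in Hg. destruct Hg as (_ & L & Hmax).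
      destruct (stage_cofinal L) as (g' & Sg' & L1 & L2).
      apply (Hmax g') in Sg'; auto. apply (le_nlt Hwo) in Sg'. tauto. }
    rewrite (path_succ Hg). destruct Hg as (Sg & Lg & Hmax).
    destruct (IH g Lg) as (I1 & I2 & I3).
    { left. split; auto. eapply lt_tr; eauto. }
    assert (Lga : g << al) by (eapply lt_tr; eauto).
    destruct (Hc Lg Lb' (I2 Lga)) as [C1 C2].
    repeat split; auto.
    + apply (HT Lb' C1).
    + apply (HT Lb' C1).
    + intros d Sd Ld. destruct (Hmax d Sd Ld) as [L| ->]; auto.
      apply incl_trans with (y := path g); auto.
  - assert (Hunb : forall h, h << b -> exists g, stage g /\ g << b /\ h << g).
    { destruct Hb as [[Sb Lb']| ->]; [|exact stage_cofinal].
      apply stage_unbounded; auto. }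
    assert (IH' : forall g, stage g -> g << b ->
      hasdom lt (path g) g /\ forall d, stage d -> d << g -> incl (path d) (path g)).
    { intros g Sg Lg. destruct (IH g Lg) as (? & _ & ?); auto.
      left. split; auto. apply (lt_le_tr Hwo Lg Lb). }
    (* Two stages above [h] give the same value at [h], since by induction the path at the lower one
       is included in the path at the higher one. *)
    assert (Hval : forall g, stage g -> g << b -> forall h, h << g -> path b h = path g h).
    { intros g Sg Lg h Lh. rewrite (path_limit h Nb N). cbv zeta.
      destruct (excluded_middle_informative _) as [E|E]; [|exfalso; apply E; eauto].
      apply (epsilon_spec (inhabits b)) in E.
      set (e := epsilon _ _) in *. destruct E as (Se & Le & Lhe).
      destruct (IH' g Sg Lg) as [I1 I2]. destruct (IH' e Se Le) as [J1 J2].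
      destruct (lt_tri Hwo e g) as [L|[->|L]]; auto.
      - destruct (dom_some J1 Lhe) as [v Ev]. rewrite Ev. symmetry. apply (I2 e); auto.
      - destruct (dom_some I1 Lh) as [v Ev]. rewrite Ev. apply (J2 g); auto. }
    assert (Hdom : hasdom lt (path b) b).
    { intros h. split.
      - intros E. rewrite (path_limit h Nb N) in E. cbv zeta in E.
        destruct (excluded_middle_informative _) as [(g & _ & L1 & L2)|]; [|tauto].
        eapply lt_tr; eauto.
      - intros Lh. destruct (Hunb h Lh) as (g & Sg & Lg & Lhg).
        rewrite (Hval g Sg Lg h Lhg). apply (IH' g Sg Lg); auto. }
    repeat split; try apply Hdom.
    + intros Lb'. destruct Hb as [[Sb _]| ->]; [|elim (lt_irr Hwo Lb')].
      destruct (stage_ge Sb) as [Lab|?]; [|exfalso; auto].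
      apply Hacc; auto. apply stage_acc; auto.
    + intros g Sg Lg h v E. rewrite (Hval g Sg Lg h); auto.
      apply (some_dom (proj1 (IH' g Sg Lg)) E).
Qed.

End Path.

(** Locality: only [D] and [c] strictly below [b] matter. The third hypothesis rules out that [c] is
    applied at [b] itself, where nothing is assumed about it. Used both to unfold the recursion and
    to exploit coherence. *)
Lemma path_agree D D' c c' a x b :
  (forall g, g << b -> (D g <-> D' g)) ->
  (forall g t, g << b -> c g t = c' g t) ->
  (b = a \/ ~ exists g, is_max_below (stage D a) b g) ->
  path D c a x b = path D' c' a x b.
Proof.
  intros HD Hc Hb.
  assert (HS : forall g, g << b -> (stage D a g <-> stage D' a g)).
  { intros g L. unfold stage. rewrite (HD g L). tauto. }
  (* The bound is weak because this serves the limit points inside the induction and finally [b]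
     itself. *)
  assert (Hlim : forall e, e <<= b ->
    (forall g, g << e -> path D c a x g = path D' c' a x g) -> e <> a ->
    ~ (exists g, is_max_below (stage D a) e g) -> path D c a x e = path D' c' a x e).
  { intros e Le IH Ne N. apply functional_extensionality; intros h.
    rewrite (path_limit c x h Ne N).
    rewrite path_limit; auto.
    2:{ intros [g Hg]. apply N. exists g. eapply is_max_below_agree; [|exact Hg].
        intros d Hd. symmetry. apply HS. apply (lt_le_tr Hwo Hd Le). }
    assert (E : (fun g => stage D' a g /\ g << e /\ h << g) =
                (fun g => stage D a g /\ g << e /\ h << g)).
    { apply ext_pred. intros g. split; intros (? & L & ?); repeat split; auto;
        apply HS; auto; apply (lt_le_tr Hwo L Le). }
    rewrite E. cbv zeta.
    destruct (excluded_middle_informative _) as [F|F]; auto.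
    rewrite IH; auto. apply (epsilon_spec (inhabits e)) in F. apply F. }
  assert (H : forall g, g << b -> path D c a x g = path D' c' a x g).
  { intros g. induction g as [g IH] using (well_founded_ind (wo_wf Hwo)). intros Hg.
    assert (IH' : forall e, e << g -> path D c a x e = path D' c' a x e).
    { intros e He. apply IH; auto. eapply lt_tr; eauto. }
    destruct (classic (g = a)) as [->|Ng].
    { rewrite !path_start; auto. }
    destruct (classic (exists e, is_max_below (stage D a) g e)) as [[e He]|N].
    - rewrite (path_succ c x He).
      assert (He' : is_max_below (stage D' a) g e).
      { eapply is_max_below_agree; [|exact He]. intros d Hd. apply HS.
        eapply lt_tr; eauto. }
      rewrite (path_succ c' x He'). rewrite Hc; auto. f_equal. apply IH'. apply He.
    - apply Hlim; auto. left; auto. }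
  destruct (classic (b = a)) as [->|Nb]; [rewrite !path_start; auto|].
  apply Hlim; auto. right; auto. tauto.
Qed.

End Nodes.

(** * The tree *)

Section Construction.
Variables (K : Type) (lt : K -> K -> Prop).
Hypothesis Hwo : strict_wellorder lt.
Hypothesis Hreg : regular lt.
Hypothesis Hunc : uncountable K.

Local Notation "a << b" := (lt a b) (at level 70).
Local Notation "a <<= b" := (le lt a b) (at level 70).
Local Notation succ := (succ lt).
Local Notation M := (max_omega lt).

Variable U : node K -> Prop.
Hypothesis HUd : downward_closed lt U.
Variable guess : K -> K -> Prop.
Variable C : K -> K -> Prop.
Hypothesis HCclub : forall a, is_limit lt a -> club_in lt a (C a).
Hypothesis HCcoh : forall a g, acc lt (C a) g -> forall b, C g b <-> (C a b /\ b << g).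
(** [pr] is to become an injective pairing, and [phi a] an injection of pairs of a node of [U] at
    level [succ a] and an index into [M a]. *)
Variable pr : K * K -> K.
Variable phi : K -> node K -> nat -> K.
Variable zero : K.

(** The data of one height: the nodes of that level, and the ascent path as a function of [u] and of
    the index. *)
Definition state : Type := (node K -> Prop) * (node K -> nat -> node K).

Implicit Types S : K -> state.

(** The choice depends on the level alone. That an injection exists, so that [enum] is one, is known
    only after the levels are shown to be slim. *)
Definition enum (L : node K -> Prop) : node K -> K :=
  epsilon (inhabits (fun _ => zero)) (fun e => forall x y, L x -> L y -> e x = e y -> x = y).

(* Injective coding of nodes by ordinals; it depends only on levels up to [d], so that
   the guesses can be decoded during the recursion. *)
Definition code S (d : K) (s : node K) : K := pr (d, enum (fst (S d)) s).

Definition sealed S (b : K) (t : node K) : Prop :=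
  exists d s, d << b /\ fst (S d) s /\ incl s t /\ guess b (code S d s).

Definition sealing S (b : K) (t t' : node K) : Prop :=
  fst (S b) t' /\ incl t t' /\
  ((exists t'', fst (S b) t'' /\ incl t t'' /\ sealed S b t'') -> sealed S b t').

Definition seal S (b : K) (t : node K) : node K :=
  epsilon (inhabits t) (sealing S b t).

(* At each point of [D] only finitely many threads leave the ascent path in order to be
   sealed, but every thread does so at all but finitely many points of each block of [D]. *)
Definition follow S (D : K -> Prop) (u : node K) (n : nat) (b : K) (t : node K) : node K :=
  let w := snd (S b) (restr lt u b) n in
  if excluded_middle_informative (index Hwo D b < n /\ incl t w) then w else seal S b t.

Definition branch S (al d : K) (x : node K) : node K :=
  path Hwo (C al) (seal S) d x al.

Definition thread S (al : K) (u : node K) (n : nat) : node K :=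
  path Hwo (C al) (follow S (C al) u n) zero (@empty_node K) al.

Definition step (b : K) S : state :=
  if excluded_middle_informative (is_limit lt b) then
    (fun t => (exists d x, d << b /\ fst (S d) x /\ t = branch S b d x) \/
              (exists u n, level lt U b u /\ t = thread S b u n),
     fun u n => thread S b u n)
  else if excluded_middle_informative (exists a, b = succ a) then
    let a := epsilon (inhabits b) (fun a => b = succ a) in
    (fun t => exists x i, fst (S a) x /\ M a i /\ t = ext x a i,
     fun u n => ext (snd (S a) (restr lt u a) n) a (phi a u n))
  else (fun t => t = @empty_node K, fun _ _ => @empty_node K).

Definition tree : K -> state :=
  wfrec (wo_wf Hwo) (fun _ => False, fun _ _ => @empty_node K) step.

Definition tree_level (b : K) : node K -> Prop := fst (tree b).
Definition tree_path (b : K) : node K -> nat -> node K := snd (tree b).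

Local Notation T := tree_level.
Local Notation F := tree_path.

(** * Locality of the construction, its recursion equations, and coherence *)

Lemma seal_agree S S' b :
  (forall d, d <<= b -> S d = S' d) -> seal S b = seal S' b.
Proof.
  intros H. assert (E : forall t, sealed S b t <-> sealed S' b t).
  { intros t. split; intros (d & s & L & H1 & H2 & H3); exists d, s; unfold code in *.
    - rewrite <- H by (left; auto). auto.
    - rewrite H by (left; auto). auto. }
  apply functional_extensionality; intros t. unfold seal. f_equal.
  apply ext_pred. intros t'. unfold sealing. rewrite H by (right; auto).
  setoid_rewrite E. tauto.
Qed.

Lemma follow_agree S S' D D' u u' n b :
  (forall d, d <<= b -> S d = S' d) -> (forall d, d << b -> (D d <-> D' d)) ->
  restr lt u b = restr lt u' b -> follow S D u n b = follow S' D' u' n b.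
Proof.
  intros HS HD Hu. apply functional_extensionality; intros t. unfold follow.
  rewrite (index_agree Hwo HD), Hu, HS by (right; auto).
  rewrite (seal_agree HS). reflexivity.
Qed.

(** Provides the side condition of [path_agree] at limit heights. *)
Lemma no_max_stage al d :
  is_limit lt al -> d << al -> ~ exists g, is_max_below lt (stage lt (C al) d) al g.
Proof.
  intros Hal Hd (g & _ & L & Hmax).
  destruct (stage_cofinal Hwo (HCclub Hal) Hd L) as (g' & Sg' & L1 & L2).
  apply (le_nlt Hwo g' g); auto.
Qed.

Lemma branch_agree S S' al d x :
  is_limit lt al -> d << al -> (forall b, b << al -> S b = S' b) ->
  branch S al d x = branch S' al d x.
Proof.
  intros Hal Hd HS. apply path_agree; [tauto| |right; apply no_max_stage; auto].
  intros g t Lg. rewrite (seal_agree (S' := S')); auto.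
  intros e Le. apply HS. apply (le_lt_tr Hwo Le Lg).
Qed.

Hypothesis Hzero : forall b, ~ b << zero.

Lemma zero_lt_limit al : is_limit lt al -> zero << al.
Proof.
  intros [[b Hb] _]. destruct (lt_tri Hwo zero al) as [?|[E|L]]; auto.
  - subst. elim (Hzero Hb).
  - elim (Hzero L).
Qed.

Lemma thread_agree S S' al u n :
  is_limit lt al -> (forall b, b << al -> S b = S' b) ->
  thread S al u n = thread S' al u n.
Proof.
  intros Hal HS. apply path_agree; [tauto| |right; apply no_max_stage; auto using zero_lt_limit].
  intros g t Lg. rewrite (follow_agree (S' := S') (D' := C al) (u' := u)); auto; [|tauto].
  intros e Le. apply HS. apply (le_lt_tr Hwo Le Lg).
Qed.

Lemma tree_eq b : tree b = step b (cut lt (fun _ => False, fun _ _ => @empty_node K) b tree).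
Proof. unfold tree at 1. rewrite wfrec_eq. reflexivity. Qed.

Lemma tree_zero : tree zero = (fun t => t = @empty_node K, fun _ _ => @empty_node K).
Proof.
  rewrite tree_eq. unfold step.
  destruct (excluded_middle_informative _) as [[[b Hb] _]|_]; [elim (Hzero Hb)|].
  destruct (excluded_middle_informative _) as [[b Hb]|_]; auto.
  exfalso. apply (Hzero (b := b)). rewrite Hb at 1. apply (lt_succ Hwo Hreg Hunc).
Qed.

Lemma tree_succ a : tree (succ a) =
  (fun t => exists x i, T a x /\ M a i /\ t = ext x a i,
   fun u n => ext (F a (restr lt u a) n) a (phi a u n)).
Proof.
  rewrite tree_eq. unfold step.
  destruct (excluded_middle_informative _) as [E|_].
  { elim (succ_not_limit Hwo Hreg Hunc E). }
  destruct (excluded_middle_informative _) as [E|E]; [|exfalso; eauto].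
  assert (E' : epsilon (inhabits (succ a)) (fun a' => succ a = succ a') = a).
  { apply (succ_inj Hwo Hreg Hunc). symmetry.
    exact (epsilon_spec (inhabits (succ a)) (fun a' => succ a = succ a') E). }
  cbv zeta. rewrite E', cut_below by apply (lt_succ Hwo Hreg Hunc). reflexivity.
Qed.

Lemma T_zero t : T zero t <-> t = @empty_node K.
Proof. unfold tree_level. rewrite tree_zero. reflexivity. Qed.

Lemma F_zero u n : F zero u n = @empty_node K.
Proof. unfold tree_path. rewrite tree_zero. reflexivity. Qed.

Lemma T_succ a t : T (succ a) t <-> exists x i, T a x /\ M a i /\ t = ext x a i.
Proof. unfold tree_level at 1. rewrite tree_succ. reflexivity. Qed.

Lemma F_succ a u n : F (succ a) u n = ext (F a (restr lt u a) n) a (phi a u n).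
Proof. unfold tree_path at 1. rewrite tree_succ. reflexivity. Qed.

Lemma F_limit al u n : is_limit lt al -> F al u n = thread tree al u n.
Proof.
  intros Hal. unfold tree_path. rewrite tree_eq. unfold step.
  destruct (excluded_middle_informative _) as [_|?]; [|tauto].
  apply thread_agree; auto. intros; apply cut_below; auto.
Qed.

Lemma T_limit al t : is_limit lt al ->
  (T al t <-> (exists d x, d << al /\ T d x /\ t = branch tree al d x) \/
              (exists u n, level lt U al u /\ t = F al u n)).
Proof.
  intros Hal. setoid_rewrite (fun u n => F_limit u n Hal).
  unfold tree_level at 1. rewrite tree_eq. unfold step.
  destruct (excluded_middle_informative _) as [_|?]; [|tauto]. simpl.
  split; (intros [(d & x & L & H & E)|(u & n & H & E)]; [left; exists d, x|right; exists u, n]).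
  - rewrite cut_below in H by auto. repeat split; auto. rewrite E.
    apply branch_agree; auto. intros; apply cut_below; auto.
  - split; auto. rewrite E. apply thread_agree; auto. intros; apply cut_below; auto.
  - rewrite cut_below by auto. repeat split; auto. rewrite E. symmetry.
    apply branch_agree; auto. intros; apply cut_below; auto.
  - split; auto. rewrite E. symmetry. apply thread_agree; auto. intros; apply cut_below; auto.
Qed.

Lemma acc_limit D b : acc lt D b -> is_limit lt b.
Proof.
  intros (_ & H & _ & H2). split; auto. intros c Hc.
  destruct (H2 c Hc) as (g & [_ L] & L'). eauto.
Qed.

(** At an accumulation point [b], [C b] is [C al] cut off at [b], so the walk towards [al] passes at
    [b] through the very branch that was put into level [b]. *)
Lemma branch_coherent al b d x :
  acc lt (C al) b -> d << b -> path Hwo (C al) (seal tree) d x b = branch tree b d x.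
Proof.
  intros Hb Hd. symmetry. apply path_agree; auto.
  - intros g Lg. rewrite (HCcoh Hb g). tauto.
  - right. apply no_max_stage; auto. apply (acc_limit Hb).
Qed.

(** As for branches; in addition the positions computed by [index] and the restrictions of [u] used
    below [b] are the same for [al] and for [b]. *)
Lemma thread_coherent al b u n :
  acc lt (C al) b ->
  path Hwo (C al) (follow tree (C al) u n) zero (@empty_node K) b = F b (restr lt u b) n.
Proof.
  intros Hb. pose proof (acc_limit Hb) as Hlim. rewrite (F_limit _ _ Hlim).
  symmetry. apply path_agree; auto.
  - intros g Lg. rewrite (HCcoh Hb g). tauto.
  - intros g t Lg. rewrite (follow_agree (S' := tree) (D' := C al) (u' := u)); auto.
    + intros d Ld. rewrite (HCcoh Hb d). split; [tauto|]. split; auto. apply (lt_tr Hwo Ld Lg).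
    + apply (restr_restr Hwo). left; auto.
  - right. apply no_max_stage; auto. apply zero_lt_limit; auto.
Qed.

Lemma seal_spec b t :
  (exists t', T b t' /\ incl t t') ->
  T b (seal tree b t) /\ incl t (seal tree b t) /\
  ((exists t', T b t' /\ incl t t' /\ sealed tree b t') -> sealed tree b (seal tree b t)).
Proof.
  intros (t' & H1 & H2). apply (epsilon_spec (inhabits t) (sealing tree b t)).
  destruct (classic (exists t'', T b t'' /\ incl t t'' /\ sealed tree b t''))
    as [(t'' & H3 & H4 & H5)|N].
  - exists t''. repeat split; auto.
  - exists t'. repeat split; auto. intros E. elim (N E).
Qed.

(** * Heights, downward closure and extension of nodes *)

Definition inv (b : K) : Prop :=
  (forall t, T b t -> hasdom lt t b) /\
  (forall t a, T b t -> a <<= b -> T a (restr lt t a)) /\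
  (forall a x, a <<= b -> T a x -> exists y, T b y /\ incl x y) /\
  (forall u n, level lt U b u -> T b (F b u n)).

Lemma U_restr b u a : level lt U b u -> a <<= b -> level lt U a (restr lt u a).
Proof.
  intros [H1 H2] L. split; [apply (proj2 HUd u b a H1 H2 L)|].
  apply (restr_hasdom Hwo H2 L).
Qed.

Section Limit.
Variable al : K.
Hypothesis Hal : is_limit lt al.
Hypothesis IH : forall b, b << al -> inv b.

Lemma seal_step g b t :
  g << b -> b << al -> T g t -> T b (seal tree b t) /\ incl t (seal tree b t).
Proof.
  intros L Lb Ht. destruct (IH Lb) as (_ & _ & I3 & _).
  destruct (seal_spec (I3 g t (or_introl L) Ht)) as (H1 & H2 & _). auto.
Qed.

Lemma follow_step u n g b t :
  level lt U al u -> g << b -> b << al -> T g t ->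
  T b (follow tree (C al) u n b t) /\ incl t (follow tree (C al) u n b t).
Proof.
  intros Hu L Lb Ht. unfold follow. destruct (excluded_middle_informative _) as [[_ E]|_].
  - split; auto. apply (IH Lb). apply (U_restr Hu). left; auto.
  - apply seal_step with (g := g); auto.
Qed.

Lemma branch_spec d x b : d << al -> T d x ->
  (stage lt (C al) d b /\ b << al) \/ b = al ->
  let p := path Hwo (C al) (seal tree) d x in
  hasdom lt (p b) b /\ (b << al -> T b (p b)) /\
  forall g, stage lt (C al) d g -> g << b -> incl (p g) (p b).
Proof.
  intros Hd Hx Hb p.
  apply (path_spec (T := T) (al := al)); auto.
  - intros e t Le. apply (IH Le).
  - intros g e t. apply seal_step.
  - intros e Le Lde He. rewrite branch_coherent by auto.
    apply (T_limit _ (acc_limit He)). left. eauto.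
Qed.

Lemma thread_spec u n b : level lt U al u ->
  (stage lt (C al) zero b /\ b << al) \/ b = al ->
  let p := path Hwo (C al) (follow tree (C al) u n) zero (@empty_node K) in
  hasdom lt (p b) b /\ (b << al -> T b (p b)) /\
  forall g, stage lt (C al) zero g -> g << b -> incl (p g) (p b).
Proof.
  intros Hu Hb p.
  apply (path_spec (T := T) (al := al)); auto.
  - intros e t Le. apply (IH Le).
  - apply zero_lt_limit; auto.
  - apply T_zero. reflexivity.
  - intros g e t. apply follow_step; auto.
  - intros e Le _ He. rewrite thread_coherent by auto.
    apply (IH Le). apply (U_restr Hu). left; auto.
Qed.

(** A node of a limit level is approximated cofinally by tree nodes below it, namely the values of
    its path at the stages; this yields closure under restriction. *)
Lemma limit_node t : T al t -> hasdom lt t al /\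
  forall a, a << al -> exists g p, a << g /\ g << al /\ T g p /\ incl p t.
Proof.
  intros Ht. apply (T_limit _ Hal) in Ht.
  destruct Ht as [(d & x & Ld & Hx & ->)|(u & n & Hu & ->)].
  - destruct (branch_spec Ld Hx (or_intror eq_refl)) as (H1 & _ & H3). split; auto.
    intros a La. destruct (stage_cofinal Hwo (HCclub Hal) Ld La) as (g & Sg & L1 & L2).
    exists g, (path Hwo (C al) (seal tree) d x g). repeat split; auto.
    apply (branch_spec Ld Hx); auto.
  - rewrite (F_limit _ _ Hal).
    destruct (thread_spec n Hu (or_intror eq_refl)) as (H1 & _ & H3). split; auto.
    intros a La.
    destruct (stage_cofinal Hwo (HCclub Hal) (zero_lt_limit Hal) La) as (g & Sg & L1 & L2).
    exists g, (path Hwo (C al) (follow tree (C al) u n) zero (@empty_node K) g).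
    repeat split; auto.
    apply (thread_spec n Hu); auto.
Qed.

Lemma inv_limit : inv al.
Proof.
  repeat split.
  - apply (limit_node H).
  - apply (limit_node H).
  - intros t a Ht [La| ->].
    + destruct (limit_node Ht) as [_ H2].
      destruct (H2 a La) as (g & p & L1 & L2 & Hp & Hi).
      destruct (IH L2) as (J1 & J2 & _).
      rewrite (restr_eq (x := restr lt p a) (a := a)).
      * apply J2; auto. left; auto.
      * apply (restr_hasdom Hwo (J1 p Hp)). left; auto.
      * apply (incl_trans (@restr_incl _ lt p a) Hi).
    + rewrite (restr_eq (x := t)); auto; [apply (limit_node Ht)|apply incl_refl].
  - intros a x [La| ->] Hx; [|exists x; split; auto; apply incl_refl].
    exists (branch tree al a x). split.
    + apply (T_limit _ Hal). left. eauto.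
    + destruct (branch_spec La Hx (or_intror eq_refl)) as (_ & _ & H3).
      assert (E := H3 a (or_introl eq_refl) La). rewrite path_start in E. exact E.
  - intros u n Hu. apply (T_limit _ Hal). right. eauto.
Qed.

End Limit.

Hypothesis Hphi : forall b u n, level lt U (succ b) u -> M b (phi b u n).

Lemma is_zero a : (forall b, ~ b << a) -> a = zero.
Proof.
  intros H. destruct (lt_tri Hwo a zero) as [L|[E|L]]; auto.
  - elim (Hzero L).
  - elim (H _ L).
Qed.

Lemma inv_all b : inv b.
Proof.
  induction b as [b IH] using (well_founded_ind (wo_wf Hwo)).
  destruct (zero_succ_limit Hwo Hreg Hunc b) as [Hb|[[a ->]|Hb]].
  - rewrite (is_zero Hb) in *. clear b Hb.
    assert (Hd : forall a, a <<= zero -> a = zero).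
    { intros a [L|E]; auto. elim (Hzero L). }
    unfold inv. setoid_rewrite T_zero. repeat split.
    + subst t. apply (empty_hasdom Hzero).
    + subst t. apply (empty_hasdom Hzero).
    + intros t a -> L. apply Hd in L. subst a. apply T_zero.
      apply (restr_eq (a := zero)); [apply (empty_hasdom Hzero)|apply incl_refl].
    + intros a x L Hx. apply Hd in L. subst a. apply T_zero in Hx. subst x.
      exists (@empty_node K). split; auto. apply incl_refl.
    + intros u n _. apply F_zero.
  - destruct (IH a (lt_succ Hwo Hreg Hunc a)) as (I1 & I2 & I3 & I4).
    assert (Hdom : forall t, T (succ a) t -> hasdom lt t (succ a)).
    { intros t Ht. apply T_succ in Ht. destruct Ht as (x & i & Hx & Hi & ->).
      apply (ext_hasdom Hwo); auto. apply (succ_spec Hwo Hreg Hunc). }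
    repeat split; try (apply Hdom; auto).
    + intros t c Ht [L| ->].
      * apply T_succ in Ht. destruct Ht as (x & i & Hx & Hi & ->).
        apply (lt_succ_le Hwo Hreg Hunc) in L.
        rewrite (restr_eq (x := restr lt x c) (a := c)).
        -- apply I2; auto.
        -- apply (restr_hasdom Hwo (I1 x Hx) L).
        -- apply (incl_trans (@restr_incl _ lt x c)). apply (ext_incl Hwo i (I1 x Hx)).
      * rewrite (restr_eq (x := t)); auto. apply incl_refl.
    + intros c x [L| ->] Hx; [|exists x; split; auto; apply incl_refl].
      apply (lt_succ_le Hwo Hreg Hunc) in L. destruct (I3 c x L Hx) as (y & Hy & Hi).
      destruct (infinite_max_omega Hwo Hunc a) as (h & Hh & _).
      exists (ext y a (h 0)). split.
      * apply T_succ. exists y, (h 0). auto.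
      * apply (incl_trans Hi). apply (ext_incl Hwo _ (I1 y Hy)).
    + intros u n Hu. apply T_succ. rewrite F_succ.
      exists (F a (restr lt u a) n), (phi a u n). repeat split; auto.
      apply I4. apply (U_restr Hu). left. apply (lt_succ Hwo Hreg Hunc).
  - apply inv_limit; auto.
Qed.

Lemma T_dom b t : T b t -> hasdom lt t b.
Proof. apply (inv_all b). Qed.

Lemma T_restr b t a : T b t -> a <<= b -> T a (restr lt t a).
Proof. apply (inv_all b). Qed.

Lemma T_extend a b x : a <<= b -> T a x -> exists y, T b y /\ incl x y.
Proof. apply (inv_all b). Qed.

Lemma F_T b u n : level lt U b u -> T b (F b u n).
Proof. apply (inv_all b). Qed.

Lemma T_inhabited b : exists t, T b t.
Proof.
  destruct (@T_extend zero b (@empty_node K)) as (y & Hy & _); [|apply T_zero; auto|eauto].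
  apply (le_nlt Hwo). apply Hzero.
Qed.

(** * Size of the levels *)

Hypothesis HUs : slim lt U.

(** A node is coded by its height together with its image under a chosen injection of its level into
    [M al]. *)
Lemma below_le_max_omega al :
  (forall d, d << al -> le_card (T d) (M d)) ->
  le_card (fun p => fst p << al /\ T (fst p) (snd p)) (M al).
Proof.
  intros H.
  assert (E : forall d, exists f : node K -> K, d << al ->
    (forall x, T d x -> M al (f x)) /\ (forall x y, T d x -> T d y -> f x = f y -> x = y)).
  { intros d. destruct (classic (d << al)) as [L|N].
    - destruct (le_card_trans (H d L) (max_omega_mono Hwo (or_introl L))) as [f Hf]. exists f; auto.
    - exists (fun _ => zero). tauto. }
  apply choice in E. destruct E as [f Hf].
  eapply le_card_trans; [|apply (max_omega_square Hwo Hunc)].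
  exists (fun p => (fst p, f (fst p) (snd p))). split.
  - intros [d x] [L Hx]. simpl in *. split; simpl; [left; auto|apply (Hf d L); auto].
  - intros [d x] [d' x'] [L Hx] [L' Hx'] E. simpl in *. inversion E; subst.
    f_equal. apply (Hf d' L); auto.
Qed.

(** At a limit, branches are indexed by the nodes of lower levels and threads by a node of [U] at
    that level and a natural number; slimness of [U] bounds the latter. *)
Lemma T_slim b : le_card (T b) (M b).
Proof.
  induction b as [b IH] using (well_founded_ind (wo_wf Hwo)).
  destruct (zero_succ_limit Hwo Hreg Hunc b) as [Hb|[[a ->]|Hb]].
  - rewrite (is_zero Hb). destruct (infinite_max_omega Hwo Hunc zero) as (h & Hh & _).
    exists (fun _ => h 0). split; auto. intros x y Hx Hy _.
    apply T_zero in Hx. apply T_zero in Hy. congruence.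
  - assert (L := lt_succ Hwo Hreg Hunc a).
    apply le_card_trans with (B := prod_set (T a) (M a)).
    + apply le_card_surj with (g := fun p => ext (fst p) a (snd p)).
      { exact (@empty_node K, zero). }
      intros t Ht. apply T_succ in Ht. destruct Ht as (x & i & Hx & Hi & ->).
      exists (x, i). repeat split; auto.
    + apply le_card_trans with (B := prod_set (M a) (M a)).
      * apply le_card_prod; [apply IH; auto|apply le_card_incl; auto].
      * apply (le_card_trans (max_omega_square Hwo Hunc a)). apply (max_omega_mono Hwo). left; auto.
  - assert (H1 := below_le_max_omega IH).
    assert (H2 : le_card (prod_set (level lt U b) (fun _ : nat => True)) (M b)).
    { eapply le_card_trans; [|apply (max_omega_square Hwo Hunc)]. apply le_card_prod.
      - apply (le_card_trans (HUs b)). apply (segment_plus_nat_le_max_omega Hwo Hunc).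
      - apply (nat_le_max_omega Hwo Hunc). }
    eapply le_card_trans; [|exact (sum_le_max_omega Hwo Hunc H1 H2)].
    apply le_card_surj with (g := fun s => match s with
      | inl p => branch tree b (fst p) (snd p) | inr p => F b (fst p) (snd p) end).
    { left. exact (zero, @empty_node K). }
    intros t Ht. apply (T_limit _ Hb) in Ht.
    destruct Ht as [(d & x & Ld & Hx & ->)|(u & n & Hu & ->)].
    + exists (inl (d, x)). auto.
    + exists (inr (u, n)). repeat split; auto; apply Hu.
Qed.

(** * The ascent path *)

Lemma cofinite_mono (Z Z' : nat -> Prop) :
  (forall n, Z n -> Z' n) -> cofinite Z -> cofinite Z'.
Proof. intros H. apply finite_incl. intros n N E. apply N; auto. Qed.

Lemma cofinite_and (Z Z' : nat -> Prop) :
  cofinite Z -> cofinite Z' -> cofinite (fun n => Z n /\ Z' n).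
Proof.
  intros H H'. apply (finite_incl (B := fun n => ~ Z n \/ ~ Z' n)).
  - intros n N. apply not_and_or; auto.
  - apply finite_union; auto.
Qed.

Lemma cofinite_above (m : nat) : cofinite (fun n => m < n).
Proof.
  apply (finite_incl (B := fun n => n < S m)); [intros; lia|apply finite_nat_below].
Qed.

Lemma cofinite_all (Z : nat -> Prop) : (forall n, Z n) -> cofinite Z.
Proof. intros H. exists nil. intros n N. elim (N (H n)). Qed.

Definition ascending (b : K) : Prop := forall v a, level lt U b v -> a <<= b ->
  cofinite (fun n => incl (F a (restr lt v a) n) (F b v n)).

Lemma restr_self b v : level lt U b v -> restr lt v b = v.
Proof. intros [_ H]. apply (restr_eq H). apply incl_refl. Qed.

(** Let [g] be the predecessor of [b]. For all but finitely many [n] the thread is at [F g] by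
    induction, [F g] lies below [F b], and [n] exceeds the index of [b]; then [follow] moves to
    [F b]. At a limit of stages coherence gives the equality for every [n], so finite exceptional
    sets never accumulate. *)
Lemma thread_follows al u b :
  is_limit lt al -> (forall g, g << al -> ascending g) -> level lt U al u ->
  stage lt (C al) zero b -> b << al ->
  cofinite (fun n =>
    path Hwo (C al) (follow tree (C al) u n) zero (@empty_node K) b = F b (restr lt u b) n).
Proof.
  intros Hal Hasc Hu. induction b as [b IH] using (well_founded_ind (wo_wf Hwo)).
  intros Sb Lb. destruct (classic (b = zero)) as [->|Nb].
  { apply cofinite_all. intros n. rewrite path_start, F_zero. reflexivity. }
  destruct (classic (exists g, is_max_below lt (stage lt (C al) zero) b g)) as [[g Hg]|N].
  - pose proof Hg as (Sg & Lg & _).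
    assert (Ub := U_restr Hu (or_introl Lb)).
    assert (H1 := Hasc b Lb _ g Ub (or_introl Lg)).
    assert (H2 := IH g Lg Sg (lt_tr Hwo Lg Lb)).
    assert (H3 := cofinite_above (index Hwo (C al) b)).
    eapply cofinite_mono; [|exact (cofinite_and H1 (cofinite_and H2 H3))].
    intros n (E1 & E2 & E3). cbv beta in *.
    rewrite (path_succ Hwo _ _ Hg).
    unfold follow at 1. destruct (excluded_middle_informative _) as [_|M1]; auto.
    exfalso. apply M1. split; auto. rewrite E2.
    rewrite (restr_restr Hwo) in E1 by (left; auto). exact E1.
  - apply cofinite_all. intros n. apply thread_coherent.
    apply (stage_acc Hwo (HCclub Hal) Lb Sb Nb N).
Qed.

Lemma thread_ascends al u a :
  is_limit lt al -> (forall g, g << al -> ascending g) -> level lt U al u -> a << al ->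
  exists b, a << b /\ b << al /\
    cofinite (fun n => incl (F b (restr lt u b) n) (F al u n)).
Proof.
  intros Hal Hasc Hu La.
  destruct (stage_cofinal Hwo (HCclub Hal) (zero_lt_limit Hal) La) as (b & Sb & L1 & L2).
  exists b. repeat split; auto.
  eapply cofinite_mono; [|exact (thread_follows Hal Hasc Hu Sb L1)].
  intros n E. cbv beta in E. rewrite <- E, (F_limit _ _ Hal).
  apply (thread_spec Hal (fun b _ => inv_all b) n Hu (or_intror eq_refl)); auto.
Qed.

Lemma ascending_all b : ascending b.
Proof.
  induction b as [b IH] using (well_founded_ind (wo_wf Hwo)).
  intros v a Hv [La| ->].
  2:{ apply cofinite_all. intros n. rewrite (restr_self Hv). apply incl_refl. }
  destruct (zero_succ_limit Hwo Hreg Hunc b) as [Hb|[[c ->]|Hb]].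
  - elim (Hb a La).
  - apply (lt_succ_le Hwo Hreg Hunc) in La.
    assert (Lc := lt_succ Hwo Hreg Hunc c).
    assert (Uc := U_restr Hv (or_introl Lc)).
    eapply cofinite_mono; [|exact (IH c Lc _ a Uc La)].
    intros n E. cbv beta in E. rewrite (restr_restr Hwo) in E by auto.
    apply (incl_trans E). rewrite F_succ. apply (ext_incl Hwo _ (T_dom (F_T n Uc))).
  - destruct (thread_ascends Hb IH Hv La) as (c & L1 & L2 & H).
    assert (Uc := U_restr Hv (or_introl L2)).
    eapply cofinite_mono; [|exact (cofinite_and H (IH c L2 _ a Uc (or_introl L1)))].
    intros n [E1 E2]. rewrite (restr_restr Hwo) in E2 by (left; auto).
    apply (incl_trans E2 E1).
Qed.

Hypothesis Hphi_inj : forall b u u' n n', level lt U (succ b) u -> level lt U (succ b) u' ->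
  phi b u n = phi b u' n' -> u = u' /\ n = n'.

(** At successors [phi] gives different last values. At a limit, [u] and [v] already differ below
    some [c << b]; for almost all [n] the two nodes extend the values at [c], which differ for
    almost all [n] by induction. *)
Lemma F_distinct b u v : level lt U b u -> level lt U b v -> u <> v ->
  cofinite (fun n => F b u n <> F b v n).
Proof.
  revert u v. induction b as [b IH] using (well_founded_ind (wo_wf Hwo)). intros u v Hu Hv N.
  destruct (zero_succ_limit Hwo Hreg Hunc b) as [Hb|[[c ->]|Hb]].
  - exfalso. apply N. destruct Hu as [_ Hu], Hv as [_ Hv].
    rewrite (hasdom_empty Hb Hu), (hasdom_empty Hb Hv). reflexivity.
  - apply cofinite_all. intros n E. rewrite !F_succ in E.
    assert (Lc := lt_succ Hwo Hreg Hunc c).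
    apply (ext_inj Hwo (T_dom (F_T n (U_restr Hu (or_introl Lc))))
      (T_dom (F_T n (U_restr Hv (or_introl Lc))))) in E.
    destruct E as [_ E]. apply N. exact (proj1 (Hphi_inj Hu Hv E)).
  - assert (E : exists h, h << b /\ u h <> v h).
    { apply NNPP. intros M1. apply N. apply (incl_eq (proj2 Hu) (proj2 Hv)).
      intros h w E. rewrite <- E. symmetry. apply NNPP. intros M2. apply M1. exists h.
      split; auto. apply (some_dom (proj2 Hu) E). }
    destruct E as (h & Lh & Nh).
    destruct (thread_ascends Hb (fun g _ => @ascending_all g) Hu (limit_succ Hwo Hreg Hunc Hb Lh))
      as (c & L1 & L2 & H).
    assert (H' := ascending_all Hv (or_introl L2)).
    assert (Uc := U_restr Hu (or_introl L2)). assert (Vc := U_restr Hv (or_introl L2)).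
    assert (Nc : restr lt u c <> restr lt v c).
    { intros E. apply Nh. apply (f_equal (fun x => x h)) in E. unfold restr in E.
      destruct (excluded_middle_informative (h << c)) as [_|M1]; auto.
      exfalso. apply M1. apply (lt_tr Hwo (lt_succ Hwo Hreg Hunc h) L1). }
    eapply cofinite_mono; [|exact (cofinite_and H (cofinite_and H' (IH c L2 _ _ Uc Vc Nc)))].
    intros n (E1 & E2 & E3) E. cbv beta in *. rewrite <- E in E2.
    apply E3. apply (incl_common_eq Hwo (T_dom (F_T n Uc)) (T_dom (F_T n Vc)) E1 E2).
Qed.

(** * Sealing of dense sets *)

Hypothesis Hpr : forall p q, pr p = pr q -> p = q.

Lemma code_inj d s d' s' : T d s -> T d' s' -> code tree d s = code tree d' s' -> s = s'.
Proof.
  intros Hs Hs' E. apply Hpr in E. inversion E as [[E1 E2]]. subst d'.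
  revert E2. fold (T d).
  assert (H : exists e : node K -> K, forall x y, T d x -> T d y -> e x = e y -> x = y).
  { destruct (T_slim d) as (e & _ & He). eauto. }
  apply (epsilon_spec (inhabits (fun _ => zero))) in H. apply H; auto.
Qed.

Hypothesis Hguess : forall X : K -> Prop,
  stationary lt (fun a => forall b, b << a -> (X b <-> guess a b)).
Hypothesis HCguess : forall A : K -> Prop, cofinal lt A ->
  stationary lt (fun a => is_sup lt (fun b => C a b /\
    forall d, succ_omega lt (fun e => C a e /\ ~ lt e b) d -> A d) a).

Section Dense.
Variable D : node K -> Prop.
Hypothesis Hdense : forall d x, T d x -> exists e y, T e y /\ D y /\ incl x y.

(** At such a height every sealing move lands above an element of [D], whichever path makes it. This
    is the set to which the guessing property of [C] is applied. *)
Definition seals_into (b : K) : Prop :=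
  forall g t, g << b -> T g t ->
    exists d s, d << b /\ T d s /\ D s /\ incl s (seal tree b t).

Lemma seals_into_cofinal : cofinal lt seals_into.
Proof.
  intros a0.
  (* A closure point [b] of these bounds lies above the codes of all nodes of height below [b] and
     above the heights of their witnesses for density. *)
  assert (E : forall a, exists z, a0 << z /\ forall x, T a x -> code tree a x << z /\
    exists e y, e << z /\ T e y /\ D y /\ incl x y).
  { intros a.
    destruct (bounded_image Hwo Hreg Hunc (@empty_node K) (code tree a) (T_slim a)) as [z1 H1].
    assert (E : forall x, exists e, T a x -> exists y, T e y /\ D y /\ incl x y).
    { intros x. destruct (classic (T a x)) as [Hx|N].
      - destruct (Hdense Hx) as (e & y & Hy). exists e. eauto.
      - exists zero. tauto. }
    apply choice in E. destruct E as [f Hf].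
    destruct (bounded_image Hwo Hreg Hunc (@empty_node K) f (T_slim a)) as [z2 H2].
    exists (maxK lt (maxK lt z1 z2) (succ a0)). repeat split.
    - apply (lt_le_tr Hwo (lt_succ Hwo Hreg Hunc a0)). apply (maxK_r Hwo).
    - apply (lt_le_tr Hwo (H1 x H)). apply (le_tr Hwo (maxK_l lt z1 z2)). apply maxK_l.
    - destruct (Hf x H) as (y & Hy). exists (f x), y. split; auto.
      apply (lt_le_tr Hwo (H2 x H)). apply (le_tr Hwo (maxK_r Hwo z1 z2)). apply maxK_l. }
  apply choice in E. destruct E as [g Hg].
  (* The set to be guessed consists of the codes of the elements of [D] in the tree. *)
  destruct (Hguess (fun c => exists d s, T d s /\ D s /\ c = code tree d s)
    (club_closed_under Hwo Hreg Hunc g)) as (b & [[a La] Hcl] & Hb).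
  (* The values of [g] exceed [a0], and [b] has a predecessor [a], whence [a0 << g a << b]. *)
  exists b. split; [|left; apply (lt_tr Hwo (b := g a)); [apply Hg|auto]].
  intros d t Ld Ht. destruct (proj2 (Hg d) t Ht) as (_ & e & y & Le & Hy & Dy & Hi).
  assert (Leb : e << b) by (apply (lt_tr Hwo Le); auto).
  (* Lifted to level [b], the witness [y] gives a sealed extension of [t], so [seal] has to choose a
     sealed one. *)
  destruct (T_extend (or_introl Leb) Hy) as (y' & Hy' & Hi').
  assert (Htb : incl t y') by (apply (incl_trans Hi Hi')).
  destruct (seal_spec (ex_intro _ y' (conj Hy' Htb))) as (_ & _ & H).
  assert (Hcode : forall d s, d << b -> T d s -> code tree d s << b).
  { intros d' s L Hs. apply (lt_tr Hwo (b := g d')); auto. apply (Hg d'); auto. }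
  destruct H as (d' & s & L & Hs & His & G).
  { exists y'. repeat split; auto. exists e, y. repeat split; auto.
    apply Hb; auto. exists e, y. auto. }
  apply Hb in G; auto. destruct G as (d'' & s' & Hs' & Ds & E).
  exists d', s. repeat split; auto. rewrite (code_inj Hs Hs' E). exact Ds.
Qed.

(** From [b], pass repeatedly to the next point of [C al]. Finitely many steps stay within the
    [omega] points following [b], and each raises the index by one, so an index of at least [m] is
    reached; [e'] is one further step. *)
Lemma block_points al b m :
  is_limit lt al -> C al b ->
  exists e e', b <<= e /\ C al e /\ e' << al /\ is_max_below lt (C al) e' e /\
    C al e' /\ m <= index Hwo (C al) e /\
    succ_omega lt (fun x => C al x /\ ~ x << b) e'.
Proof.
  intros Hal Cb. destruct (HCclub Hal) as (C1 & C2 & _).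
  assert (Hnext : forall e, C al e -> b <<= e ->
    finite_set (fun x => (C al x /\ ~ x << b) /\ x << e) ->
    exists e', C al e' /\ e' << al /\ is_max_below lt (C al) e' e /\ b <<= e' /\
      succ_omega lt (fun x => C al x /\ ~ x << b) e').
  { intros e Ce Lbe Hfin.
    destruct (least Hwo (P := fun x => C al x /\ e << x)) as (e' & [Ce' Le] & Hmin).
    { apply C2, C1; auto. }
    assert (Hmax : forall d, C al d -> d << e' -> d <<= e).
    { intros d Cd Ld. apply (le_nlt Hwo). intros L.
      apply (proj1 (le_nlt Hwo e' d)); auto. }
    assert (Lbe' : b <<= e') by (left; apply (le_lt_tr Hwo Lbe Le)).
    exists e'. repeat split; auto.
    - apply (le_nlt Hwo); auto.
    - exists e. repeat split; auto. apply (le_nlt Hwo); auto.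
    - apply (finite_incl (B := fun x => ((C al x /\ ~ x << b) /\ x << e) \/ x = e)).
      + intros x [[Cx Nx] Lx]. destruct (Hmax x Cx Lx) as [?|?]; auto.
      + apply finite_union; auto. exists (e :: nil). intros x ->. simpl; auto. }
  assert (Hind : exists e, C al e /\ b <<= e /\ m <= index Hwo (C al) e /\
    finite_set (fun x => (C al x /\ ~ x << b) /\ x << e)).
  { induction m as [|m IH].
    - exists b. repeat split; auto; [right; auto|lia|]. exists nil. tauto.
    - destruct IH as (e & Ce & Lbe & Hm & Hfin).
      destruct (Hnext e Ce Lbe Hfin) as (e' & Ce' & _ & Hmax & Lbe' & (_ & _ & Hfin')).
      exists e'. repeat split; auto. rewrite (index_succ Hwo Hmax). lia. }
  destruct Hind as (e & Ce & Lbe & Hm & Hfin).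
  destruct (Hnext e Ce Lbe Hfin) as (e' & Ce' & Le' & Hmax & Lbe' & Hso).
  exists e, e'. auto 10.
Qed.

Lemma stage_max al d e e' :
  d << e -> C al e -> is_max_below lt (C al) e' e ->
  is_max_below lt (stage lt (C al) d) e' e.
Proof.
  intros Ld Ce (_ & L & Hmax). repeat split; auto.
  - right; auto.
  - intros x [->|[Cx _]] Lx; auto. left; auto.
Qed.

(** The guessing property gives blocks of [omega] consecutive points of [C al] in [seals_into],
    cofinally in [al]. A branch is sealed at any such point beyond its start. The thread with index
    [n] may follow the ascent path at early points of a block, which is why arbitrarily long blocks
    are needed. *)
Lemma level_above_dense : exists al,
  forall t, T al t -> exists d s, d << al /\ T d s /\ D s /\ incl s t.
Proof.
  destruct (HCguess seals_into_cofinal (club_limit Hwo Hreg Hunc)) as (al & Hal & [_ Hsup]).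
  exists al. intros t Ht. apply (T_limit _ Hal) in Ht.
  assert (IH : forall b, b << al -> inv b) by (intros; apply inv_all).
  destruct Ht as [(d & x & Ld & Hx & ->)|(u & n & Hu & ->)].
  - destruct (Hsup d Ld) as (b & [Cb Hb] & Lb).
    destruct (block_points 0 Hal Cb) as (e & e' & Lbe & Ce & Le' & Hmax & Ce' & _ & Hso).
    assert (Lde : d << e) by (apply (lt_le_tr Hwo Lb Lbe)).
    assert (Lee : e << e') by apply Hmax.
    destruct (branch_spec Hal IH (b := e) Ld Hx) as (_ & Te & _).
    { left. split; [right; auto|]. apply (lt_tr Hwo Lee Le'). }
    destruct (branch_spec Hal IH Ld Hx (or_intror eq_refl)) as (_ & _ & Hi).
    destruct (Hb e' Hso e _ Lee (Te (lt_tr Hwo Lee Le'))) as (d' & s & L & Hs & Ds & His).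
    exists d', s. repeat split; auto. { apply (lt_tr Hwo L Le'). }
    apply (incl_trans His).
    rewrite <- (path_succ Hwo (seal tree) x (stage_max Lde Ce Hmax)). apply Hi; auto.
    right. split; auto. apply (lt_tr Hwo Lde Lee).
  - destruct (Hsup zero (zero_lt_limit Hal)) as (b & [Cb Hb] & Lb).
    (* The index of [e] is at least [n], so that of [e'] exceeds [n] and the thread cannot take the
       first alternative of [follow] at [e']. *)
    destruct (block_points n Hal Cb) as (e & e' & Lbe & Ce & Le' & Hmax & Ce' & Hn & Hso).
    assert (Lde : zero << e) by (apply (lt_le_tr Hwo Lb Lbe)).
    assert (Lee : e << e') by apply Hmax.
    destruct (thread_spec Hal IH (b := e) n Hu) as (_ & Te & _).
    { left. split; [right; auto|]. apply (lt_tr Hwo Lee Le'). }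
    destruct (thread_spec Hal IH n Hu (or_intror eq_refl)) as (_ & _ & Hi).
    destruct (Hb e' Hso e _ Lee (Te (lt_tr Hwo Lee Le'))) as (d' & s & L & Hs & Ds & His).
    exists d', s. repeat split; auto. { apply (lt_tr Hwo L Le'). }
    apply (incl_trans His). rewrite (F_limit _ _ Hal).
    assert (E : seal tree e' (path Hwo (C al) (follow tree (C al) u n) zero (@empty_node K) e) =
      path Hwo (C al) (follow tree (C al) u n) zero (@empty_node K) e').
    { rewrite (path_succ Hwo (follow tree (C al) u n) (@empty_node K) (stage_max Lde Ce Hmax)).
      unfold follow at 2. destruct (excluded_middle_informative _) as [[Hlt _]|_]; auto.
      rewrite (index_succ Hwo Hmax) in Hlt. lia. }
    rewrite E. apply Hi; auto. right. split; auto. apply (lt_tr Hwo Lde Lee).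
Qed.

End Dense.

(** * The Souslin tree and its ascent path *)

Definition whole : node K -> Prop := fun t => exists a, T a t.

Lemma level_whole a t : level lt whole a t <-> T a t.
Proof.
  split.
  - intros [[b Hb] Ha]. rewrite (hasdom_unique Hwo Ha (T_dom Hb)). exact Hb.
  - intros H. split; [exists a; auto|apply (T_dom H)].
Qed.

Lemma no_big_antichain A : antichain lt whole A -> ~ le_card (fun _ : K => True) A.
Proof.
  intros [HA Hanti] Hbig.
  set (D := fun t => (exists s, A s /\ incl s t) \/
    (forall y, whole y -> incl t y -> forall s, A s -> ~ incl s y)).
  destruct (level_above_dense (D := D)) as [al Hal].
  { intros d x Hx.
    destruct (classic (exists e y s, T e y /\ incl x y /\ A s /\ incl s y))
      as [(e & y & s & Hy & Hi & As & His)|N].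
    - exists e, y. repeat split; auto. left; eauto.
    - exists d, x. repeat split; [auto| |apply incl_refl].
      right. intros y [e Hy] Hi s As His. apply N. exists e, y, s. auto. }
  apply (@not_K_le_max_omega K lt Hwo Hreg Hunc al).
  apply (le_card_trans Hbig).
  eapply le_card_trans; [|apply (below_le_max_omega (al := al)); intros; apply T_slim].
  apply le_card_surj with (g := snd); [exact (zero, @empty_node K)|].
  intros s As. destruct (HA s As) as [a Ha]. exists (a, s). repeat split; auto. simpl.
  apply NNPP. intros N. apply (le_nlt Hwo) in N.
  (* Suppose [s] in [A] has height at least [al]. Its restriction to [al] extends some [s0] in [D]
     of lower height. Either [s0] extends an element of [A], which is then strictly below [s], or no
     extension of [s0] is above an element of [A], although [s] is. *)
  destruct (Hal _ (T_restr Ha N)) as (d & s0 & Ld & Hs0 & [(s1 & As1 & Hi)|Hr] & Hi0).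
  - assert (Hi1 : incl s1 s).
    { apply (incl_trans Hi), (incl_trans Hi0), restr_incl. }
    destruct (HA s1 As1) as [a1 Ha1].
    assert (L1 : a1 << a).
    { apply (le_lt_tr Hwo (hasdom_le Hwo (T_dom Ha1) (T_dom Hs0) Hi)).
      apply (lt_le_tr Hwo Ld N). }
    destruct (Hanti s1 s As1 As) as [Nsub _].
    + intros ->. apply (lt_irr Hwo (a := a)).
      rewrite (hasdom_unique Hwo (T_dom Ha) (T_dom Ha1)) at 1. exact L1.
    + apply Nsub. apply (sub_incl (T_dom Ha1) (T_dom Ha) L1 Hi1).
  - apply (Hr s) with (s := s); [exists a; auto| |auto|apply incl_refl].
    apply (incl_trans Hi0), restr_incl.
Qed.

(* The immediate successors leaving a cofinal branch form an antichain. *)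
Lemma no_cofinal_branch : ~ exists b : K -> K, forall a, whole (brestr lt b a).
Proof.
  intros [b Hb].
  assert (E : forall a, exists i, M a i /\ i <> b a).
  { intros a. destruct (infinite_max_omega Hwo Hunc a) as (h & Hh & Ih).
    destruct (classic (h 0 = b a)) as [E|N]; [|exists (h 0); auto].
    exists (h 1). split; auto. rewrite <- E. intros E'. apply Ih in E'; auto. discriminate. }
  apply choice in E. destruct E as [i Hi].
  set (off := fun a => ext (brestr lt b a) a (i a)).
  assert (Hoff : forall a a', a << a' -> ~ incl (off a) (off a') /\ ~ incl (off a') (off a)).
  { intros a a' L.
    assert (E1 : off a a = Some (i a)) by apply ext_at.
    assert (E2 : off a' a = Some (b a)).
    { unfold off, ext. destruct (excluded_middle_informative _) as [->|_].
      - elim (lt_irr Hwo L).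
      - unfold brestr. destruct (excluded_middle_informative _); tauto. }
    split; intros H; [apply H in E1|apply H in E2]; destruct (Hi a) as [_ N];
      apply N; congruence. }
  apply (@no_big_antichain (fun t => exists a, t = off a)).
  - split.
    + intros t [a ->]. exists (succ a). apply T_succ.
      exists (brestr lt b a), (i a). repeat split; [|apply Hi].
      apply level_whole. split; auto. apply brestr_hasdom.
    + intros x y [a ->] [a' ->] N.
      destruct (lt_tri Hwo a a') as [L|[->|L]]; [|tauto|];
        split; intros Hs; apply incl_sub in Hs; destruct (Hoff _ _ L); auto.
  - exists off. split; [eauto|]. intros a a' _ _ E.
    destruct (lt_tri Hwo a a') as [L|[?|L]]; auto; exfalso;
      apply (proj1 (Hoff _ _ L)); rewrite E; apply incl_refl.
Qed.

Lemma whole_downward_closed : downward_closed lt whole.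
Proof.
  split.
  - intros x [a Ha]. exists a. apply (T_dom Ha).
  - intros x a b Hx Ha L. exists b. apply (T_restr (b := a)); auto.
    apply level_whole. split; auto.
Qed.

Lemma whole_prolific : prolific lt whole.
Proof.
  intros a x i Hx Hi. exists (succ a). apply T_succ. exists x, i.
  repeat split; auto. apply level_whole; auto.
Qed.

Lemma level_whole_le_max_omega a : le_card (level lt whole a) (M a).
Proof.
  eapply le_card_trans; [|apply (T_slim a)]. apply le_card_incl. intros; apply level_whole; auto.
Qed.

Lemma whole_slim : slim lt whole.
Proof. intros a. apply (le_card_trans (level_whole_le_max_omega a)). apply (max_omega_le_sum Hwo). Qed.

Lemma whole_souslin : kappa_souslin lt whole.
Proof.
  split; [split|split].
  - intros a. destruct (T_inhabited a) as [t Ht]. exists t. apply level_whole; auto.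
  - intros a. split.
    + apply (le_card_trans (level_whole_le_max_omega a)). apply le_card_incl; auto.
    + intros H. apply (@not_K_le_max_omega K lt Hwo Hreg Hunc a).
      apply (le_card_trans H (level_whole_le_max_omega a)).
  - exact no_cofinal_branch.
  - intros (A & HA & Hbig). exact (no_big_antichain HA Hbig).
Qed.

Definition ascent (u : node K) : nat -> node K :=
  F (epsilon (inhabits zero) (hasdom lt u)) u.

Lemma ascent_eq a u : hasdom lt u a -> ascent u = F a u.
Proof.
  intros H. unfold ascent. f_equal. apply (hasdom_unique Hwo) with (x := u); auto.
  apply epsilon_spec. eauto.
Qed.

Lemma ascent_injective : injective_ascent_path lt whole U ascent.
Proof.
  split; [split; [|split]|].
  - intros u a Hu Ha n. rewrite (ascent_eq Ha). apply level_whole. apply F_T. split; auto.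
  - intros u v Hu Hv Huv. pose proof (incl_sub Huv) as Hi.
    destruct Huv as (a & b & Ha & Hb & L & _).
    eapply cofinite_mono; [|exact (ascending_all (conj Hv Hb) (or_introl L))].
    intros n E. cbv beta in E. rewrite (ascent_eq Ha), (ascent_eq Hb).
    rewrite (restr_eq Ha Hi) in E.
    apply (sub_incl (a := a) (b := b)); auto; apply T_dom, F_T; split; auto.
  - intros u v a Hu Hv Ha Hb N. rewrite (ascent_eq Ha), (ascent_eq Hb).
    apply F_distinct; auto; split; auto.
  (* Height one suffices, with all indices: there the last value is given by [phi], which separates
     indices. *)
  - intros b Hb. exists (succ zero), (fun _ => True). split; [apply cofinite_all; auto|].
    intros i j _ _ E. set (u := brestr lt b (succ zero)) in *.
    assert (Hu : level lt U (succ zero) u) by (split; [apply Hb|apply brestr_hasdom]).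
    rewrite (ascent_eq (proj2 Hu)), !F_succ in E.
    assert (U0 := U_restr Hu (or_introl (lt_succ Hwo Hreg Hunc zero))).
    apply (ext_inj Hwo (T_dom (F_T i U0)) (T_dom (F_T j U0))) in E.
    apply (Hphi_inj Hu Hu (proj2 E)).
Qed.

End Construction.

Theorem theorem4p2 (K : Type) (lt : K -> K -> Prop)
  (Hwo : strict_wellorder lt) (Hreg : regular lt) (Hunc : uncountable K)
  (U : node K -> Prop)
  (HUd : downward_closed lt U) (HUs : slim lt U) (HUt : kappa_tree lt U)
  (HP : P14 lt) :
  exists T : node K -> Prop,
    downward_closed lt T /\ prolific lt T /\ slim lt T /\ kappa_souslin lt T /\
    exists f : node K -> nat -> node K, injective_ascent_path lt T U f.
Proof.
  destruct HP as ((guess & _ & Hguess) & C & HCclub & HCcoh & HCguess).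
  destruct (inhabited_K Hunc) as [k0].
  destruct (least Hwo (P := fun _ => True)) as (zero & _ & Hz); [exists k0; auto|].
  assert (Hzero : forall b, ~ lt b zero).
  { intros b. apply (le_nlt Hwo). auto. }
  assert (Hpr : exists pr : K * K -> K, forall p q, pr p = pr q -> p = q).
  { destruct (square_le Hwo (I := fun _ => True)) as (pr & _ & Hpr).
    - intros a b _ _. exact I.
    - apply (infinite_K Hunc).
    - exists pr. intros p q E. apply Hpr; auto; split; exact I. }
  destruct Hpr as [pr Hpr].
  (* Level [succ b] of [U] is bounded by [M (succ b)], which is no larger than [M b]; this makes
     room for [phi b] among the immediate successors required by prolificness. *)
  assert (Hphi : forall b,
    le_card (prod_set (level lt U (succ lt b)) (fun _ : nat => True)) (max_omega lt b)).
  { intros b. eapply le_card_trans; [|apply (max_omega_square Hwo Hunc)]. apply le_card_prod.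
    - apply (le_card_trans (HUs (succ lt b))).
      apply (le_card_trans (segment_plus_nat_le_max_omega Hwo Hunc (succ lt b))).
      apply (max_omega_succ Hwo Hreg Hunc).
    - apply (nat_le_max_omega Hwo Hunc). }
  unfold le_card in Hphi. apply choice in Hphi. destruct Hphi as [phi Hphi].
  set (phi' := fun b u n => phi b (u, n)).
  assert (Hphi1 : forall b u n, level lt U (succ lt b) u -> max_omega lt b (phi' b u n)).
  { intros b u n Hu. apply (proj1 (Hphi b)). split; auto. }
  assert (Hphi2 : forall b u u' n n', level lt U (succ lt b) u -> level lt U (succ lt b) u' ->
    phi' b u n = phi' b u' n' -> u = u' /\ n = n').
  { intros b u u' n n' Hu Hu' E. apply (proj2 (Hphi b)) in E; try (split; auto; fail).
    inversion E; auto. }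
  exists (whole Hwo U guess C pr phi' zero).
  split; [apply whole_downward_closed; auto|].
  split; [apply whole_prolific; auto|].
  split; [apply whole_slim; auto|].
  split; [apply whole_souslin; auto|].
  exists (ascent Hwo U guess C pr phi' zero). apply ascent_injective; auto.
Qed.
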